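(* There is an absolute constant $C>0$ such that the following holds. Let $n\ge 1$, let $\mathcal{F}\subseteq S_n$ with $|\mathcal{F}|=c\cdot n!$ where $0<c<1$, let $f=2\chi_{\mathcal F}-1$, let $f_1$ be the orthogonal projection of $f$ onto $U_1$, and let $\epsilon=\mathbb{E}[(f-f_1)^2]$. Then there exists a family $\mathcal{G}\subseteq S_n$ which is a union of $dn$ pairwise disjoint 1-cosets, such that \[ |d-c|\le C\left(\epsilon^{1/7}+\frac{1}{n^{1/3}}\right)\quad\text{and}\quad \frac{|\mathcal G\,\triangle\,\mathcal F|}{n!}\le \frac{C}{\eta}\left(\epsilon^{1/7}+\frac{1}{n^{1/3}}\right), \] where $\eta=\min\{c,1-c\}$.
   Context: $S_n$ is the symmetric group on $[n]=\{1,\dots,n\}$. For $i,j\in[n]$, the 1-coset $T_{ij}=\{\pi\in S_n:\pi(i)=j\}$; we also write $T_{ij}$ for its indicator function. $U_1$ is the subspace of $\mathbb{R}^{S_n}$ spanned by $\{T_{ij}: i,j\in[n]\}$. $\mathbb{R}^{S_n}$ carries the inner product $\langle f,g\rangle=\frac1{n!}\sum_{\pi\in S_n}f(\pi)g(\pi)$, and $\mathbb{E}$ denotes expectation under the uniform probability measure on $S_n$. $\chi_{\mathcal F}$ is the indicator function of $\mathcal F$. *)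

(* Defs.v *)
(* scalars in algC (its nonnegative reals carry n.-root). *)
From HB Require Import structures.
From mathcomp Require Import all_boot all_order all_algebra all_fingroup all_field.
Set Implicit Arguments. Unset Strict Implicit. Unset Printing Implicit Defensive.
Import Order.TTheory GRing.Theory Num.Theory.
Local Open Scope ring_scope.

Definition coset1 (n : nat) (i j : 'I_n) : {set {perm 'I_n}} :=
  [set s : {perm 'I_n} | s i == j].

Definition indf (n : nat) (A : {set {perm 'I_n}}) : {perm 'I_n} -> algC :=
  fun s => (s \in A)%:R.

Definition innerS (n : nat) (f g : {perm 'I_n} -> algC) : algC :=
  (n`!%:R)^-1 * \sum_(s : {perm 'I_n}) f s * g s.

Definition expectS (n : nat) (f : {perm 'I_n} -> algC) : algC :=
  (n`!%:R)^-1 * \sum_(s : {perm 'I_n}) f s.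

Definition inU1 (n : nat) (g : {perm 'I_n} -> algC) : Prop :=
  exists a : 'I_n -> 'I_n -> algC,
    (forall i j, a i j \is Num.real) /\
    forall s, g s = \sum_(i : 'I_n) \sum_(j : 'I_n) a i j * indf (coset1 i j) s.

Definition is_projU1 (n : nat) (f f1 : {perm 'I_n} -> algC) : Prop :=
  inU1 f1 /\
  forall i j, innerS (fun s => f s - f1 s) (indf (coset1 i j)) = 0.

Definition union_disj_cosets (n : nat) (G : {set {perm 'I_n}}) (m : nat) : Prop :=
  exists S : {set 'I_n * 'I_n},
    [/\ #|S| = m,
        {in S &, forall p q, p != q -> [disjoint coset1 p.1 p.2 & coset1 q.1 q.2]}
      & G = \bigcup_(p in S) coset1 p.1 p.2].

(* Main.v *)
Require Import Defs.
From HB Require Import structures.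
From mathcomp Require Import all_boot all_order all_algebra all_fingroup all_field.
From mathcomp Require Import zify ring lra.
Set Implicit Arguments. Unset Strict Implicit. Unset Printing Implicit Defensive.
Import Order.TTheory GRing.Theory Num.Theory.
Local Open Scope ring_scope.

(** Write [f1 pi = \sum_i a i (pi i)] and, for rows [i, i'] and columns [j, j'],
    [D = a i j + a i' j' - a i j' - a i' j]: this is the change of [f1] under a
    transposition.  Split the permutation along a random family of about [n/2]
    disjoint transpositions, in two halves [A] and [B].  Flipping them makes [f1]
    affine in independent signs, with increments [X_A], [X_B]; since [f] takes only
    the values [1] and [-1] and is close to [f1], testing [f] on the four points
    obtained by flipping [A], [B], both or none shows that [X_A] and [X_B] are rarely
    both large.  Moment bounds convert this into a bound, of relative order [e ^+ 2],
    on the correlation of the [D ^+ 2] of two quadruples [(i, i', j, j')] sharing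
    neither a row nor a column.  Hence some row or column meets a positive fraction
    of the total mass of [D ^+ 2], and then, up to relative order [e ^+ 2], carries
    all of it.  If it is row [r], a Poincare inequality off that row gives that [f1]
    is L2-close to a function of [pi r], whose sign is the required dictatorship.  A
    column is a row after inverting permutations.  Finally the number of cosets is
    adjusted to the integer part of [c * n]: this makes the bound on [|d - c|] trivial
    and at most doubles the symmetric difference, up to [1 / n]. *)

(** * Sums over permutations of functions of finitely many values *)

Section Counting.
Variables (T : finType) (R : realFieldType).
Implicit Types (s t : seq T) (sigma : {perm T}).

(** A permutation found for the tails is corrected by a transposition moving [k x] to [y]; it fixes
    the entries of [t], as neither [k x] nor [y] is among them. *)
Lemma perm_map_exists s t :
  uniq s -> uniq t -> size s = size t -> exists sigma, map sigma s = t.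
Proof.
elim: s t => [|x s IHs] [|y t] //=; first by exists 1%g.
case/andP=> xs us /andP[yt ut] [/(IHs _ us ut)[k kst]].
exists (k * tperm (k x) y)%g; congr cons; first by rewrite permM tpermL.
rewrite -kst; apply/eq_in_map => z zs; rewrite permM tpermD //.
  by apply: contraNneq xs => /perm_inj->.
by apply: contraNneq yt => ->; rewrite -kst map_f.
Qed.

(* By transitivity the left-hand sum depends only on the length of [s]; average it
   over all injective [s] and exchange the sums. *)
Lemma sum_perm_map (theta : seq T -> R) s : uniq s ->
  (#|T| ^_ (size s))%:R * (\sum_(sigma : {perm T}) theta (map sigma s))
  = #|T|`!%:R * \sum_(t : (size s).-tuple T | uniq t) theta t.
Proof.
move=> us; set k := size s.
(* The conjunct [all predT t] gives [U] the shape counted by [card_uniq_tuples]. *)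
pose U := [set t : k.-tuple T | all predT t & uniq t].
have mapE (t : k.-tuple T) : uniq t ->
    \sum_(sigma : {perm T}) theta (map sigma t) = \sum_(sigma : {perm T}) theta (map sigma s).
  move=> ut; have [kappa <-] := perm_map_exists us ut (esym (size_tuple t)).
  rewrite (reindex_inj (mulgI kappa^-1%g)) /=; apply: eq_bigr => sigma _.
  congr theta; rewrite -map_comp; apply: eq_map => z /=.
  by rewrite permM permK.
have <-: \sum_(t in U) \sum_(sigma : {perm T}) theta (map sigma t)
    = (#|T| ^_ k)%:R * \sum_(sigma : {perm T}) theta (map sigma s).
  rewrite -(card_uniq_tuples k (@predT T)) mulr_natl -sumr_const.
  by apply: eq_bigr => t; rewrite inE => /andP[_ /mapE].
rewrite exchange_big /= -[X in X`!]cardsT -card_Sym mulr_natl -sumr_const.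
rewrite [LHS](eq_bigl (mem (Sym [set: T]))) /=; last first.
  move=> sigma; rewrite inE; apply/esym.
  by rewrite inE; apply/subsetP=> x; rewrite inE.
apply: eq_bigr => sigma _.
rewrite [RHS](reindex (fun t : k.-tuple T => map_tuple sigma t)) /=; last first.
  exists (fun t : k.-tuple T => map_tuple (sigma^-1)%g t) => t _; apply: val_inj;
    by rewrite /= -map_comp map_id_in // => x _ /=; rewrite ?permK ?permKV.
apply: eq_bigl => t.
by rewrite !inE all_predT map_inj_uniq //; apply: perm_inj.
Qed.

Lemma sum_tupleS k (P : pred (seq T)) (theta : seq T -> R) :
  \sum_(t : k.+1.-tuple T | P t) theta t
  = \sum_x \sum_(t : k.-tuple T | P (x :: t)) theta (x :: t).
Proof.
rewrite (partition_big (@thead _ _) predT) //=; apply: eq_bigr => x _.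
rewrite (reindex (fun t : k.-tuple T => [tuple of x :: t])) /=.
  by apply: eq_bigl => t; rewrite theadE eqxx andbT.
exists (fun t : k.+1.-tuple T => [tuple of behead t]) => [t _|t].
  exact: val_inj.
by rewrite inE => /andP[_ /eqP<-]; rewrite -tuple_eta.
Qed.

Lemma sum_tuple0 (P : pred (seq T)) (theta : seq T -> R) :
  \sum_(t : 0.-tuple T | P t) theta t = if P [::] then theta [::] else 0.
Proof.
case: ifP => P0; last by rewrite big1 // => t; rewrite tuple0 /= P0.
rewrite (big_pred1 [tuple]) // => t; rewrite [t]tuple0 /= P0.
by apply/esym/eqP.
Qed.

Lemma sum_perm1 (theta : T -> R) x :
  #|T|%:R * \sum_(sigma : {perm T}) theta (sigma x) = #|T|`!%:R * \sum_y theta y.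
Proof.
have := sum_perm_map (fun s => theta (head x s)) (isT : uniq [:: x]).
rewrite /= ffactn1 => ->; congr (_ * _).
rewrite (sum_tupleS _ (@uniq T) (head x \; theta)); apply: eq_bigr => y _.
by rewrite (sum_tuple0 (fun t => uniq (y :: t)) (fun=> theta y)).
Qed.

Lemma sum_perm2 (theta : T -> T -> R) x y : x != y ->
  (#|T| * #|T|.-1)%:R * \sum_(sigma : {perm T}) theta (sigma x) (sigma y)
  = #|T|`!%:R * \sum_u \sum_(v | v != u) theta u v.
Proof.
move=> xy; have uxy : uniq [:: x; y] by rewrite /= inE xy.
have := sum_perm_map (fun s => theta (nth x s 0) (nth x s 1)) uxy.
rewrite /= ffactnS ffactn1 => ->; congr (_ * _).
rewrite (sum_tupleS _ (@uniq T) (fun s => theta (nth x s 0) (nth x s 1))) /=.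
apply: eq_bigr => u _.
rewrite (sum_tupleS _ (fun t => (u \notin t) && uniq t) (fun t => theta u (nth x t 0))).
rewrite [RHS]big_mkcond; apply: eq_bigr => v _ /=.
rewrite (sum_tuple0 (fun t => (u \notin v :: t) && ((v \notin t) && uniq t))
   (fun=> theta u v)) /=.
by rewrite inE andbT eq_sym.
Qed.

End Counting.

(** * Random signs *)

Section SignFlips.
Variables (R : realFieldType) (I : eqType) (Omega : finType).
Variables (tau : I -> Omega -> Omega) (alpha : I -> Omega -> R).
Hypothesis tau_inj : forall s, injective (tau s).
Hypothesis alpha_odd : forall s w, alpha s (tau s w) = - alpha s w.
Hypothesis alpha_even : forall s t w, s != t -> alpha s (tau t w) = alpha s w.

(** Sums over [Omega] stand for expectations and the bijections [tau s] for independent random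
    signs: [tau s] reverses [alpha s] and fixes every other [alpha t]. *)
Definition flip_sum (A : seq I) w := \sum_(s <- A) alpha s w.
Definition flip_energy (A : seq I) w := \sum_(s <- A) alpha s w ^+ 2.
Definition flip_invariant (A : seq I) (Z : Omega -> R) :=
  forall s w, s \in A -> Z (tau s w) = Z w.
Local Notation X := flip_sum.
Local Notation W := flip_energy.

Lemma flip_energy_invariant A s w : W A (tau s w) = W A w.
Proof.
apply: eq_bigr => t _; have [->|ts] := eqVneq t s; last by rewrite alpha_even.
by rewrite alpha_odd sqrrN.
Qed.

Lemma flip_sum_invariant A s w : s \notin A -> X A (tau s w) = X A w.
Proof.
move=> sA; rewrite /X !big_seq; apply: eq_bigr => t tA.
by rewrite alpha_even //; apply: contraNneq sA => <-.
Qed.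

(** Reindexing by the bijection [tau s] turns the sum into its opposite. *)
Lemma sum_odd0 s (Z : Omega -> R) : (forall w, Z (tau s w) = Z w) ->
  \sum_w alpha s w * Z w = 0.
Proof.
move=> Zs; set S := \sum_w _; suff: S = - S by lra.
rewrite {1}/S (reindex_inj (@tau_inj s)) -sumrN /=; apply: eq_bigr => w _.
by rewrite alpha_odd Zs mulNr.
Qed.

(** The cross terms of the square are odd in some [alpha s] and cancel. The invariant weight [Z]
    allows the flips of [A] to be averaged while a power of [X B] or [W B] is carried along, and
    conversely. *)
Lemma flip_moment2 A Z : uniq A -> flip_invariant A Z ->
  \sum_w X A w ^+ 2 * Z w = \sum_w W A w * Z w.
Proof.
elim: A Z => [|s A IHA] Z /=.
  by move=> _ _; apply: eq_bigr => w _; rewrite /X /W !big_nil expr0n.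
case/andP=> sA uA ZA.
have ZA' : flip_invariant A Z by move=> t w tA; rewrite ZA // inE tA orbT.
under eq_bigr => w _.
  rewrite /X big_cons -/(X A w).
  rewrite (_ : _ * Z w = alpha s w ^+ 2 * Z w + X A w ^+ 2 * Z w
     + alpha s w * (2 * X A w * Z w)); last by ring.
  over.
rewrite !big_split /= [X in _ + X]sum_odd0 ?addr0; last first.
  by move=> w; rewrite flip_sum_invariant // ZA // mem_head.
rewrite IHA // -big_split /=; apply: eq_bigr => w _.
by rewrite /W big_cons mulrDl.
Qed.

(* The discarded terms are odd in [alpha s]; the induction closes because
   [W ^+ 2 * 3 + 6 * W * t + t ^+ 2 <= 3 * (W + t) ^+ 2] for [t = alpha s ^+ 2]. *)
Lemma flip_moment4 A Z : uniq A -> flip_invariant A Z -> (forall w, 0 <= Z w) ->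
  \sum_w X A w ^+ 4 * Z w <= 3 * \sum_w W A w ^+ 2 * Z w.
Proof.
elim: A Z => [|s A IHA] Z /=.
  by move=> _ _ _; rewrite mulr_sumr; apply: ler_sum => w _;
     rewrite /X /W !big_nil !expr0n !mul0r mulr0.
case/andP=> sA uA ZA Z0.
have ZA' : flip_invariant A Z by move=> t w tA; rewrite ZA // inE tA orbT.
under eq_bigr => w _.
  rewrite /X big_cons -/(X A w).
  rewrite (_ : _ * Z w = X A w ^+ 4 * Z w + 6 * (X A w ^+ 2 * (alpha s w ^+ 2 * Z w))
     + alpha s w ^+ 4 * Z w
     + alpha s w * ((4 * alpha s w ^+ 2 * X A w + 4 * X A w ^+ 3) * Z w)); last by ring.
  over.
rewrite !big_split /= [X in _ + X]sum_odd0 ?addr0; last first.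
  move=> w; rewrite flip_sum_invariant // ZA ?mem_head //.
  by rewrite alpha_odd sqrrN.
rewrite -mulr_sumr flip_moment2 //; last first.
  move=> t w tA; rewrite ZA' // alpha_even //.
  by apply: contraNneq sA => ->.
apply: le_trans (_ : 3 * (\sum_w W A w ^+ 2 * Z w)
   + 6 * (\sum_w W A w * (alpha s w ^+ 2 * Z w)) + \sum_w alpha s w ^+ 4 * Z w <= _).
  by rewrite !lerD2r; apply: IHA.
rewrite !mulr_sumr -!big_split /=; apply: ler_sum => w _.
rewrite /W big_cons -/(W A w).
have := Z0 w; have : 0 <= alpha s w ^+ 4 by apply: exprn_even_ge0.
move=> a4 z0; have := mulr_ge0 a4 z0; lra.
Qed.

Definition flip_all (A : seq I) w := foldr tau w A.

Lemma flip_all_inj A : injective (flip_all A).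
Proof. by elim: A => [|s A IHA] w w' //= /tau_inj/IHA. Qed.

Section Affine.
Variable (l : Omega -> R).
Hypothesis l_tau : forall s w, l (tau s w) = l w - 2 * alpha s w.

Lemma alpha_flip_all A s w : s \notin A -> alpha s (flip_all A w) = alpha s w.
Proof.
elim: A => //= t A IHA; rewrite inE negb_or => /andP[st sA].
by rewrite alpha_even // IHA.
Qed.

Lemma affine_flip_all A w : uniq A -> l (flip_all A w) = l w - 2 * X A w.
Proof.
elim: A => [|s A IHA] /=; first by rewrite /X big_nil mulr0 subr0.
case/andP=> sA uA; rewrite l_tau IHA // alpha_flip_all // /X big_cons; ring.
Qed.

Lemma flip_sum_flip_all A B w : {in B, forall s, s \notin A} ->
  X B (flip_all A w) = X B w.
Proof.
by move=> BA; rewrite /X !big_seq; apply: eq_bigr => s /BA; apply: alpha_flip_all.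
Qed.

(** Pythagoras: [k = l - X A] is invariant under the flips in [A], hence orthogonal to [X A], and
    the squares of [X A] sum to the energy. *)
Lemma sum_sqr_ge_energy A : uniq A -> \sum_w W A w <= \sum_w l w ^+ 2.
Proof.
move=> uA; pose k w := l w - X A w.
have kE s w : s \in A -> k (tau s w) = k w.
  move=> sA; rewrite /k l_tau /X !(big_rem s sA) /= alpha_odd.
  rewrite -/(X (rem s A) (tau s w)) flip_sum_invariant ?mem_rem_uniqF //.
  by rewrite /X; ring.
have XkE : \sum_w X A w * k w = 0.
  under eq_bigr do rewrite /X mulr_suml.
  by rewrite exchange_big big_seq big1 // => s sA; apply: sum_odd0 => w; apply: kE.
have := @flip_moment2 A (fun=> 1) uA (fun _ _ _ => erefl).
under eq_bigr do rewrite mulr1; under [in RHS]eq_bigr do rewrite mulr1.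
move=> <-; have -> : \sum_w l w ^+ 2 =
    \sum_w (k w ^+ 2 + (X A w * k w) * 2 + X A w ^+ 2).
  by apply: eq_bigr => w _; rewrite /k; ring.
rewrite !big_split /= -mulr_suml XkE mul0r addr0 lerDr.
by apply: sumr_ge0 => w _; apply: sqr_ge0.
Qed.

(* If [p - q - r + s] is nonzero it is at least 2 in absolute value; otherwise
   [p = q] or [p = r], so that [x] or [y] is a difference of two errors. *)
Lemma square_test (p q r s u x y L : R) : 1 <= L ->
  p ^+ 2 = 1 -> q ^+ 2 = 1 -> r ^+ 2 = 1 -> s ^+ 2 = 1 ->
  x ^+ 2 <= L -> y ^+ 2 <= L ->
  x ^+ 2 * y ^+ 2 <= L ^+ 2 * ((p - u) ^+ 2 + (q - (u - 2 * x)) ^+ 2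
    + (r - (u - 2 * y)) ^+ 2 + (s - (u - 2 * x - 2 * y)) ^+ 2).
Proof.
move=> L1 hp hq hr hs xL yL; set g1 := p - u; set g2 := q - _; set g3 := r - _.
set g4 := s - _; set G := _ + _ + _ + _.
have sg (z : R) : z ^+ 2 = 1 -> z = 1 \/ z = -1.
  by move/eqP; rewrite sqrf_eq1 => /orP[]/eqP; [left|right].
have g10 := sqr_ge0 g1; have g20 := sqr_ge0 g2; have g30 := sqr_ge0 g3.
have g40 := sqr_ge0 g4; have G0 : 0 <= G by rewrite !addr_ge0 ?sqr_ge0.
have x0 := sqr_ge0 x; have y0 := sqr_ge0 y.
have xG : p = q -> x ^+ 2 <= G.
  move=> pq; have -> : x = (g2 - g1) / 2 by rewrite /g1 /g2 pq; field.
  have := sqr_ge0 (g1 + g2); rewrite /G; lra.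
have yG : p = r -> y ^+ 2 <= G.
  move=> pr; have -> : y = (g3 - g1) / 2 by rewrite /g1 /g3 pr; field.
  have := sqr_ge0 (g1 + g3); rewrite /G; lra.
have LG : L * G <= L ^+ 2 * G.
  by rewrite expr2 -mulrA ler_peMl // mulr_ge0 //; lra.
have [pq|pq] := eqVneq p q.
  by apply: le_trans LG; rewrite [leRHS]mulrC; apply: ler_pM => //; apply: xG.
have [pr|pr] := eqVneq p r.
  by apply: le_trans LG; apply: ler_pM => //; apply: yG.
(* The affine parts cancel, so [g1 - g2 - g3 + g4 = p - q - r + s], which is here [3 * p + s]. The
   six squares below prove Cauchy-Schwarz in the form [(g1 - g2 - g3 + g4) ^+ 2 <= 4 * G]. *)
have G1 : 1 <= G.
  have : 4 <= (g1 - g2 - g3 + g4) ^+ 2.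
    rewrite /g1 /g2 /g3 /g4.
    case: (sg _ hp) pq pr => ->; case: (sg _ hq) => ->; case: (sg _ hr) => ->;
      case: (sg _ hs) => ->; rewrite ?eqxx // => _ _; lra.
  have := sqr_ge0 (g1 + g2); have := sqr_ge0 (g1 + g3); have := sqr_ge0 (g1 - g4).
  have := sqr_ge0 (g2 - g3); have := sqr_ge0 (g2 + g4); have := sqr_ge0 (g3 + g4).
  rewrite /G; lra.
apply: le_trans (_ : L * L <= _); first exact: ler_pM.
by rewrite -expr2 ler_peMr // sqr_ge0.
Qed.

(** By [flip_moment2], applied to [A] and then to [B], the left side is the sum of
    [X A ^+ 2 * X B ^+ 2]. Where both squares are at most [L], [square_test] applies; elsewhere one
    more factor [X A ^+ 2 / L] or [X B ^+ 2 / L] is inserted and fourth moments finish. *)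
Lemma energy_product (f : Omega -> R) A B (L : R) : 1 <= L ->
  (forall w, f w ^+ 2 = 1) -> uniq A -> uniq B -> {in B, forall s, s \notin A} ->
  \sum_w W A w * W B w <= 4 * L ^+ 2 * (\sum_w (f w - l w) ^+ 2)
    + 3 / L * (\sum_w (W A w ^+ 2 * W B w + W A w * W B w ^+ 2)).
Proof.
move=> L1 f1 uA uB BA; have L0 : 0 < L by lra.
have AB : {in A, forall s, s \notin B}.
  by move=> s sA; apply/negP => /BA; rewrite sA.
have XinvB : flip_invariant A (X B) by move=> s w sA; apply: flip_sum_invariant; apply: AB.
have XinvA : flip_invariant B (X A) by move=> s w sA; apply: flip_sum_invariant; apply: BA.
have sw (F G : Omega -> R) : \sum_w F w * G w = \sum_w G w * F w.
  by apply: eq_bigr => w _; rewrite mulrC.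
have e22 : \sum_w X A w ^+ 2 * X B w ^+ 2 = \sum_w W A w * W B w.
  rewrite flip_moment2 //; last by move=> s w sA; rewrite XinvB.
  rewrite (sw (W A)) flip_moment2 //.
  by move=> s w sB; rewrite flip_energy_invariant.
have e42 : \sum_w X A w ^+ 4 * X B w ^+ 2 <= 3 * \sum_w W A w ^+ 2 * W B w.
  apply: le_trans (flip_moment4 uA _ _) _ => [s w sA|w|]; rewrite ?XinvB ?sqr_ge0 //.
  rewrite (sw (fun w => W A w ^+ 2)) flip_moment2 //; first by rewrite sw.
  by move=> s w sB; rewrite flip_energy_invariant.
have e24 : \sum_w X A w ^+ 2 * X B w ^+ 4 <= 3 * \sum_w W A w * W B w ^+ 2.
  rewrite (sw (fun w => X A w ^+ 2)); apply: le_trans (flip_moment4 uB _ _) _ => [s w sA|w|];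
    rewrite ?XinvA ?sqr_ge0 //.
  rewrite (sw (fun w => W B w ^+ 2)) flip_moment2 //.
  by move=> s w sB; rewrite flip_energy_invariant.
pose g w := (f w - l w) ^+ 2.
(* Flips are bijections, so the errors at the four tested points have equal sums; hence the factor
   4. *)
have gE C (h : Omega -> R) : \sum_w h (flip_all C w) = \sum_w h w.
  by rewrite [RHS](reindex_inj (@flip_all_inj C)).
rewrite -e22.
have pw w : X A w ^+ 2 * X B w ^+ 2 <=
    L ^+ 2 * (g w + g (flip_all A w) + g (flip_all B w) + g (flip_all B (flip_all A w)))
    + L^-1 * (X A w ^+ 4 * X B w ^+ 2 + X A w ^+ 2 * X B w ^+ 4).
  set x := X A w; set y := X B w.
  have x0 := sqr_ge0 x; have y0 := sqr_ge0 y.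
  have g0 v : 0 <= g v by apply: sqr_ge0.
  have gp : 0 <= L ^+ 2 * (g w + g (flip_all A w) + g (flip_all B w) + g (flip_all B (flip_all A w))).
    by rewrite mulr_ge0 ?sqr_ge0 // !addr_ge0.
  have hp : 0 <= L^-1 * (x ^+ 4 * y ^+ 2 + x ^+ 2 * y ^+ 4).
    by rewrite mulr_ge0 ?invr_ge0 ?(ltW L0) // addr_ge0 // mulr_ge0 // exprn_even_ge0.
  have [xL|xL] := leP (x ^+ 2) L; last first.
    apply: le_trans (_ : L^-1 * (x ^+ 4 * y ^+ 2 + x ^+ 2 * y ^+ 4) <= _); last lra.
    rewrite ler_pdivlMl //.
    have h1 : 0 <= (x ^+ 2 - L) * (x ^+ 2 * y ^+ 2).
      by apply: mulr_ge0; [rewrite subr_ge0 ltW | exact: mulr_ge0].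
    have h2 : 0 <= x ^+ 2 * y ^+ 4 by rewrite mulr_ge0 // exprn_even_ge0.
    lra.
  have [yL|yL] := leP (y ^+ 2) L; last first.
    apply: le_trans (_ : L^-1 * (x ^+ 4 * y ^+ 2 + x ^+ 2 * y ^+ 4) <= _); last lra.
    rewrite ler_pdivlMl //.
    have h1 : 0 <= (y ^+ 2 - L) * (x ^+ 2 * y ^+ 2).
      by apply: mulr_ge0; [rewrite subr_ge0 ltW | exact: mulr_ge0].
    have h2 : 0 <= x ^+ 4 * y ^+ 2 by rewrite mulr_ge0 // exprn_even_ge0.
    lra.
  apply: le_trans (_ : L ^+ 2 * (g w + g (flip_all A w) + g (flip_all B w)
     + g (flip_all B (flip_all A w))) <= _); last by rewrite lerDl.
  rewrite /g !affine_flip_all // flip_sum_flip_all //.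
  exact: square_test.
apply: le_trans (ler_sum _ (fun w _ => pw w)) _.
rewrite big_split /= -!mulr_sumr !big_split /=.
rewrite (gE A (fun w => g (flip_all B w))) !(gE _ g).
have Li : 0 <= L^-1 by rewrite invr_ge0 ltW.
have := ler_wpM2l Li e42; have := ler_wpM2l Li e24.
rewrite -[\sum_w (f w - l w) ^+ 2]/(\sum_w g w).
by move=> h1 h2; lra.
Qed.

End Affine.
End SignFlips.

(** * Mixed differences of a matrix *)

Section Quads.
Variables (R : realFieldType) (T : finType) (a : T -> T -> R).
Local Notation n := #|T|.
Local Notation quad := (T * T * (T * T))%type.

Definition lin (pi : {perm T}) := \sum_i a i (pi i).
Definition mixed i i' j j' := a i j + a i' j' - a i j' - a i' j.
(** A [quad] holds two rows, then two columns. Repetitions are allowed, since they make the mixed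
    difference vanish. *)
Definition quadE (Q : quad) := mixed Q.1.1 Q.1.2 Q.2.1 Q.2.2 ^+ 2.
Definition quad_disjoint (Q1 Q2 : quad) :=
  uniq [:: Q1.1.1; Q1.1.2; Q2.1.1; Q2.1.2] && uniq [:: Q1.2.1; Q1.2.2; Q2.2.1; Q2.2.2].
Definition mass := \sum_(Q : quad) quadE Q.
Definition disjoint_mass :=
  \sum_(Q1 : quad) \sum_(Q2 : quad | quad_disjoint Q1 Q2) quadE Q1 * quadE Q2.

Lemma quadE_ge0 Q : 0 <= quadE Q. Proof. exact: sqr_ge0. Qed.

Lemma mass_ge0 : 0 <= mass.
Proof. by apply: sumr_ge0 => Q _; apply: quadE_ge0. Qed.

Lemma mixed_diagl i j j' : mixed i i j j' = 0.
Proof. by rewrite /mixed; ring. Qed.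

Lemma mixed_diagr i i' j : mixed i i' j j = 0.
Proof. by rewrite /mixed; ring. Qed.

Lemma sum_perm_pair (theta : seq T -> seq T -> R) s : uniq s ->
  (n ^_ (size s))%:R ^+ 2 *
    (\sum_(sigma : {perm T}) \sum_(rho : {perm T}) theta (map sigma s) (map rho s))
  = n`!%:R ^+ 2 * \sum_(t : (size s).-tuple T | uniq t)
      \sum_(t' : (size s).-tuple T | uniq t') theta t t'.
Proof.
move=> us; rewrite !expr2 -!mulrA.
rewrite [X in _ * X = _]mulr_sumr.
under eq_bigr => sigma _ do rewrite (sum_perm_map (theta (map sigma s)) us).
rewrite -mulr_sumr mulrCA; congr (_ * _).
by rewrite (sum_perm_map (fun u => \sum_(t : (size s).-tuple T | uniq t) theta u t) us).
Qed.

Variables (k : nat) (p q : 'I_k -> T).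
Hypothesis p_inj : injective p.
Hypothesis q_inj : injective q.
Hypothesis pq_neq : forall s t, p s != q t.

Local Notation Omega := ({perm T} * {perm T})%type.

(** [w.1] and [w.2] list rows and columns by position; the rows at positions [p s] and [q s] are
    exchanged while the columns stay. *)
Definition swap_pos (s : 'I_k) (w : Omega) : Omega := ((tperm (p s) (q s) * w.1)%g, w.2).
(** Halved because a swap changes [lin] by a full mixed difference, which [l_tau] writes as twice
    the odd variable. *)
Definition half_mixed (s : 'I_k) (w : Omega) :=
  mixed (w.1 (p s)) (w.1 (q s)) (w.2 (p s)) (w.2 (q s)) / 2.
(* With [w.1], [w.2] uniform and independent, [pair_perm w] is a uniform permutation
   carrying the [w.1 (p s), w.1 (q s)] to the [w.2 (p s), w.2 (q s)]. *)
Definition pair_perm (w : Omega) : {perm T} := (w.1^-1 * w.2)%g.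

Lemma swap_pos_inj s : injective (swap_pos s).
Proof. by move=> [s1 r1] [s2 r2] [/mulgI-> ->]. Qed.

Lemma half_mixed_odd s w : half_mixed s (swap_pos s w) = - half_mixed s w.
Proof. by rewrite /half_mixed /= !permM tpermL tpermR /mixed; ring. Qed.

Lemma half_mixed_even s t w : s != t -> half_mixed s (swap_pos t w) = half_mixed s w.
Proof.
move=> st; rewrite /half_mixed /= !permM !tpermD // ?(inj_eq p_inj) ?(inj_eq q_inj);
  by rewrite ?pq_neq // eq_sym ?pq_neq.
Qed.

Lemma lin_pair w : lin (pair_perm w) = \sum_x a (w.1 x) (w.2 x).
Proof.
rewrite /lin (reindex_inj (@perm_inj _ w.1)) /=; apply: eq_bigr => x _.
by rewrite permM permK.
Qed.

Lemma lin_swap s w :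
  lin (pair_perm (swap_pos s w)) = lin (pair_perm w) - 2 * half_mixed s w.
Proof.
rewrite !lin_pair /= (bigD1 (p s)) // (bigD1 (q s)) 1?eq_sym ?pq_neq //=.
rewrite [in RHS](bigD1 (p s)) // [in RHS](bigD1 (q s)) 1?eq_sym ?pq_neq //=.
rewrite !permM tpermL tpermR.
rewrite (eq_bigr (fun x => a (w.1 x) (w.2 x))) => [|x /andP[xp xq]].
  by rewrite /half_mixed /mixed; field.
by rewrite permM tpermD 1?eq_sym.
Qed.

(** Each permutation arises as [s^-1 * r] from one [r] for every [s]. *)
Lemma sum_pair_perm (h : {perm T} -> R) :
  \sum_w h (pair_perm w) = n`!%:R * \sum_pi h pi.
Proof.
rewrite -(pair_big predT predT (fun s r => h (s^-1 * r)%g)) /=.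
rewrite -[X in X`!]cardsT -card_Sym mulr_natl -sumr_const.
rewrite [RHS](eq_bigl predT) => [|s]; last first.
  by rewrite inE; apply/subsetP => x; rewrite inE.
apply: eq_bigr => s _; rewrite [RHS](reindex_inj (mulgI s^-1%g)) /=.
by [].
Qed.

(** Two fixed positions receive all pairs of distinct rows and of distinct columns equally often.
    Degenerate quadruples contribute 0, so the whole [mass] appears; the 4 is the square of the
    halving. *)
Lemma sum_half_mixed2 s :
  (n ^_ 2)%:R ^+ 2 * (\sum_w half_mixed s w ^+ 2) = n`!%:R ^+ 2 * (mass / 4).
Proof.
have us : uniq [:: p s; q s] by rewrite /= inE pq_neq.
have := sum_perm_pair (fun t u => (mixed (nth (p s) t 0) (nth (p s) t 1)
  (nth (p s) u 0) (nth (p s) u 1) / 2) ^+ 2) us.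
rewrite (pair_bigA _ (fun _ _ => _)) /= => ->; congr (_ * _).
rewrite /mass mulr_suml pair_big_dep /=.
rewrite (reindex (fun Q : quad => ([tuple Q.1.1; Q.1.2], [tuple Q.2.1; Q.2.2]))) /=.
  rewrite big_mkcond; apply: eq_bigr => -[[i i'] [j j']] _; rewrite /quadE /=.
  rewrite !inE !andbT; have [->|_] := eqVneq i i'; first by rewrite mixed_diagl expr0n /= mul0r.
  have [->|_] := eqVneq j j'; first by rewrite mixed_diagr expr0n /= mul0r.
  by rewrite /=; field.
exists (fun t : 2.-tuple T * 2.-tuple T =>
   ((tnth t.1 0, tnth t.1 1), (tnth t.2 0, tnth t.2 1))).
  by move=> [[? ?] [? ?]] _.
move=> [[[|? [|? []]] //= ?] [[|? [|? []]] //= ?]] _.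
by congr (_, _); apply: val_inj.
Qed.

Lemma sum_half_mixed22 s t : s != t ->
  (n ^_ 4)%:R ^+ 2 * (\sum_w half_mixed s w ^+ 2 * half_mixed t w ^+ 2)
    = n`!%:R ^+ 2 * (disjoint_mass / 16).
Proof.
move=> st; have us : uniq [:: p s; q s; p t; q t].
  rewrite /= !inE !negb_or !pq_neq [q s == p t]eq_sym !pq_neq.
  by rewrite (inj_eq p_inj) (inj_eq q_inj) st.
have := sum_perm_pair (fun t u => (mixed (nth (p s) t 0) (nth (p s) t 1)
  (nth (p s) u 0) (nth (p s) u 1) / 2) ^+ 2 *
  (mixed (nth (p s) t 2) (nth (p s) t 3) (nth (p s) u 2) (nth (p s) u 3) / 2) ^+ 2) us.
rewrite (pair_bigA _ (fun _ _ => _)) /= => ->; congr (_ * _).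
rewrite /disjoint_mass mulr_suml; under [RHS]eq_bigr do rewrite mulr_suml.
rewrite !pair_big_dep /=.
rewrite (reindex (fun Q : quad * quad =>
  ([tuple Q.1.1.1; Q.1.1.2; Q.2.1.1; Q.2.1.2],
   [tuple Q.1.2.1; Q.1.2.2; Q.2.2.1; Q.2.2.2]))) /=.
  by apply: eq_bigr => Q _; rewrite /quadE /=; field.
exists (fun t : 4.-tuple T * 4.-tuple T =>
   ((tnth t.1 0, tnth t.1 1, (tnth t.2 0, tnth t.2 1)),
    (tnth t.1 2, tnth t.1 3, (tnth t.2 2, tnth t.2 3)))).
  by move=> [[[? ?] [? ?]] [[? ?] [? ?]]] _.
move=> [[[|? [|? [|? [|? []]]]] //= ?] [[|? [|? [|? [|? []]]]] //= ?]] _.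
by congr (_, _); apply: val_inj.
Qed.

Lemma disjoint_mass_le : disjoint_mass <= mass ^+ 2.
Proof.
rewrite /disjoint_mass expr2 [in leRHS]/mass mulr_suml; apply: ler_sum => Q1 _.
rewrite mulr_sumr big_mkcond; apply: ler_sum => Q2 _.
by case: ifP => // _; rewrite mulr_ge0 // quadE_ge0.
Qed.

(** For three quadruples an upper bound suffices: by nonnegativity, dropping the disjointness
    condition leaves the cube of [mass]. *)
Lemma sum_half_mixed222 s t u : s != t -> s != u -> t != u ->
  (n ^_ 6)%:R ^+ 2 *
    (\sum_w half_mixed s w ^+ 2 * half_mixed t w ^+ 2 * half_mixed u w ^+ 2)
    <= n`!%:R ^+ 2 * (mass ^+ 3 / 64).
Proof.
move=> st su tu; have us : uniq [:: p s; q s; p t; q t; p u; q u].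
  rewrite /= !inE !negb_or !pq_neq ![q _ == p _]eq_sym !pq_neq.
  by rewrite !(inj_eq p_inj) !(inj_eq q_inj) st su tu.
have := sum_perm_pair (fun t u => (mixed (nth (p s) t 0) (nth (p s) t 1)
  (nth (p s) u 0) (nth (p s) u 1) / 2) ^+ 2 *
  (mixed (nth (p s) t 2) (nth (p s) t 3) (nth (p s) u 2) (nth (p s) u 3) / 2) ^+ 2 *
  (mixed (nth (p s) t 4) (nth (p s) t 5) (nth (p s) u 4) (nth (p s) u 5) / 2) ^+ 2) us.
rewrite (pair_bigA _ (fun _ _ => _)) /= => ->; rewrite ler_wpM2l ?sqr_ge0 //.
rewrite !pair_big_dep /= (_ : mass ^+ 3 / 64 = \sum_(Q : quad * (quad * quad))
   quadE Q.1 / 4 * (quadE Q.2.1 / 4 * (quadE Q.2.2 / 4))); last first.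
  rewrite -(pair_bigA _ (fun Q1 Q => quadE Q1 / 4 * (quadE Q.1 / 4 * (quadE Q.2 / 4)))) /=.
  under eq_bigr do rewrite -mulr_sumr.
  rewrite -mulr_suml -(pair_bigA _ (fun Q1 Q => quadE Q1 / 4 * (quadE Q / 4))) /=.
  under [X in _ = _ * X]eq_bigr do rewrite -mulr_sumr.
  by rewrite -!mulr_suml -/mass; field.
rewrite (reindex (fun Q : quad * (quad * quad) =>
  ([tuple Q.1.1.1; Q.1.1.2; Q.2.1.1.1; Q.2.1.1.2; Q.2.2.1.1; Q.2.2.1.2],
   [tuple Q.1.2.1; Q.1.2.2; Q.2.1.2.1; Q.2.1.2.2; Q.2.2.2.1; Q.2.2.2.2]))) /=.
  have e0 Q : 0 <= quadE Q / 4 by rewrite mulr_ge0 ?quadE_ge0 ?invr_ge0 ?ler0n.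
  rewrite big_mkcond; apply: ler_sum => Q _.
  case: ifP => _; last by rewrite mulr_ge0 // mulr_ge0.
  rewrite /quadE /=.
  by rewrite le_eqVlt; apply/orP; left; apply/eqP; field.
exists (fun t : 6.-tuple T * 6.-tuple T =>
   ((tnth t.1 0, tnth t.1 1, (tnth t.2 0, tnth t.2 1)),
    ((tnth t.1 2, tnth t.1 3, (tnth t.2 2, tnth t.2 3)),
     (tnth t.1 4, tnth t.1 5, (tnth t.2 4, tnth t.2 5))))).
  by move=> [[[? ?] [? ?]] [[[? ?] [? ?]] [[? ?] [? ?]]]] _.
move=> [[[|? [|? [|? [|? [|? [|? []]]]]]] //= ?] [[|? [|? [|? [|? [|? [|? []]]]]]] //= ?]] _.
by congr (_, _); apply: val_inj.
Qed.

End Quads.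

(** * Moments of the energies of two disjoint families of transpositions *)

Section QuadEnergy.
Variables (R : realFieldType) (T : finType) (a : T -> T -> R).
Local Notation n := #|T|.
Variables (k : nat) (p q : 'I_k -> T).
Hypothesis p_inj : injective p.
Hypothesis q_inj : injective q.
Hypothesis pq_neq : forall s t, p s != q t.
Hypothesis n_ge6 : (6 <= n)%N.
Hypothesis mixed_le4 : forall i i' j j', `|mixed a i i' j j'| <= 4.

Local Notation W := (flip_energy (half_mixed a p q)).
Local Notation alpha := (half_mixed a p q).
(** [beta1] and [beta2] are the averages over [Omega] of [alpha s ^+ 2] and of the product of two
    such squares with distinct indices; [beta3] bounds the average for three. *)
Local Notation beta1 := (mass a / (4 * (n ^_ 2)%:R ^+ 2)).
Local Notation beta2 := (disjoint_mass a / (16 * (n ^_ 4)%:R ^+ 2)).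
Local Notation beta3 := (mass a ^+ 3 / (64 * (n ^_ 6)%:R ^+ 2)).

Lemma ffact_neq0 j : (j <= 6)%N -> (n ^_ j)%:R != 0 :> R.
Proof. by move=> j6; rewrite pnatr_eq0 -lt0n ffact_gt0 (leq_trans j6). Qed.

Lemma ffact_gt0R j : (j <= 6)%N -> 0 < (n ^_ j)%:R :> R.
Proof. by move=> j6; rewrite lt0r ffact_neq0 // ler0n. Qed.

Lemma sum_half_mixed2E s : \sum_w alpha s w ^+ 2 = n`!%:R ^+ 2 * beta1.
Proof.
have f0 := ffact_neq0 (isT : (2 <= 6)%N).
apply: (mulfI (expf_neq0 2 f0)); rewrite sum_half_mixed2 //.
by field.
Qed.

Lemma sum_half_mixed22E s t : s != t ->
  \sum_w alpha s w ^+ 2 * alpha t w ^+ 2 = n`!%:R ^+ 2 * beta2.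
Proof.
have f0 := ffact_neq0 (isT : (4 <= 6)%N).
move=> st; apply: (mulfI (expf_neq0 2 f0)); rewrite sum_half_mixed22 //.
by field.
Qed.

Lemma sum_half_mixed222_le s t u : s != t -> s != u -> t != u ->
  \sum_w alpha s w ^+ 2 * alpha t w ^+ 2 * alpha u w ^+ 2 <= n`!%:R ^+ 2 * beta3.
Proof.
have f0 := ffact_neq0 (isT : (6 <= 6)%N).
have fp : 0 < (n ^_ 6)%:R ^+ 2 :> R by rewrite exprn_gt0 // ffact_gt0R.
move=> st su tu; rewrite -(ler_pM2l fp).
apply: le_trans (sum_half_mixed222 a p_inj q_inj pq_neq st su tu) _.
by rewrite le_eqVlt; apply/orP; left; apply/eqP; field.
Qed.

(** A repeated index costs a factor 4, since [alpha] is half a mixed difference and so at most 2 in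
    absolute value. *)
Lemma sum_half_mixed42_le s t : s != t ->
  \sum_w alpha s w ^+ 2 * alpha s w ^+ 2 * alpha t w ^+ 2
    <= n`!%:R ^+ 2 * (4 * beta2).
Proof.
move=> st; rewrite mulrCA -(sum_half_mixed22E st) mulr_sumr; apply: ler_sum => w _.
rewrite -mulrA; apply: ler_wpM2r; first by apply: mulr_ge0; apply: sqr_ge0.
rewrite /half_mixed; set d := mixed _ _ _ _ _.
have : `|d| ^+ 2 <= 4 ^+ 2 by rewrite lerXn2r ?nnegrE ?mixed_le4.
by rewrite real_normK ?num_real //; lra.
Qed.

Variables (A B : seq 'I_k).
Hypothesis uA : uniq A.
Hypothesis uB : uniq B.
Hypothesis BA : {in B, forall s, s \notin A}.

Lemma sum_energy : \sum_w W A w = n`!%:R ^+ 2 * ((size A)%:R * beta1).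
Proof.
rewrite exchange_big /= (eq_bigr _ (fun s _ => sum_half_mixed2E s)).
by rewrite big_const_seq count_predT iter_addr_0 -mulr_natl; ring.
Qed.

Lemma sum_energy_energy : \sum_w W A w * W B w
  = n`!%:R ^+ 2 * ((size A)%:R * (size B)%:R * beta2).
Proof.
under eq_bigr => w _.
  rewrite /W mulr_suml; under eq_bigr do rewrite mulr_sumr; over.
rewrite exchange_big big_seq /=.
under eq_bigr => s sA.
  rewrite exchange_big big_seq /=.
  under eq_bigr => t tB.
    rewrite sum_half_mixed22E; last by apply: contraTneq sA => ->; apply: BA.
    over.
  rewrite -big_seq big_const_seq count_predT iter_addr_0; over.
rewrite -big_seq big_const_seq count_predT iter_addr_0 -[RHS]mulrA -!mulrnA.
by rewrite -mulr_natr natrM; ring.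
Qed.

(** Expand into triples [s, s'] in [A] and [t] in [B]. Triples with [s != s'] are bounded through
    [beta3]; those with [s = s'], only [size A * size B] many, through [4 * beta2]. *)
Lemma sum_energy2_energy_le : \sum_w W A w ^+ 2 * W B w
  <= n`!%:R ^+ 2 * ((size A)%:R ^+ 2 * (size B)%:R * beta3
                    + (size A)%:R * (size B)%:R * (4 * beta2)).
Proof.
set b2 := n`!%:R ^+ 2 * (4 * beta2); set b3 := n`!%:R ^+ 2 * beta3.
have b30 : 0 <= b3.
  by rewrite mulr_ge0 ?sqr_ge0 // divr_ge0 ?mulr_ge0 ?sqr_ge0 ?exprn_ge0 ?mass_ge0.
have -> : \sum_w W A w ^+ 2 * W B w =
   \sum_(s <- A) \sum_(s' <- A) \sum_(t <- B)
     \sum_w alpha s w ^+ 2 * alpha s' w ^+ 2 * alpha t w ^+ 2.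
  under [RHS]eq_bigr do under eq_bigr do rewrite exchange_big.
  under [RHS]eq_bigr do rewrite exchange_big.
  rewrite [RHS]exchange_big /=; apply: eq_bigr => w _.
  rewrite expr2 -mulrA /W mulr_suml; apply: eq_bigr => s _.
  rewrite mulr_suml mulr_sumr; apply: eq_bigr => s' _.
  by rewrite !mulr_sumr; apply: eq_bigr => t _; rewrite mulrA.
have step s s' : s \in A -> s' \in A ->
   \sum_(t <- B) \sum_w alpha s w ^+ 2 * alpha s' w ^+ 2 * alpha t w ^+ 2
   <= (size B)%:R * (b3 + (s' == s)%:R * b2).
  move=> sA s'A; rewrite mulr_natl -iter_addr_0 -count_predT -big_const_seq.
  rewrite big_seq [leRHS]big_seq; apply: ler_sum => t tB.
  have st u : u \in A -> u != t by move=> uA'; apply: contraTneq uA' => ->; apply: BA.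
  have [->|ss'] := eqVneq s' s.
    by rewrite mul1r; apply: le_trans (sum_half_mixed42_le (st _ sA)) _; rewrite lerDr.
  by rewrite mul0r addr0; apply: sum_half_mixed222_le; rewrite ?st // eq_sym.
apply: le_trans (_ : \sum_(s <- A) \sum_(s' <- A)
   (size B)%:R * (b3 + (s' == s)%:R * b2) <= _).
  rewrite big_seq [leRHS]big_seq; apply: ler_sum => s sA.
  by rewrite big_seq [leRHS]big_seq; apply: ler_sum => s' s'A; apply: step.
rewrite big_seq.
under eq_bigr => s sA.
  rewrite (_ : \sum_(s' <- A) _ = (size B)%:R * ((size A)%:R * b3 + b2)); first over.
  rewrite -mulr_sumr; congr (_ * _).
  rewrite big_split /= big_const_seq count_predT iter_addr_0 mulr_natl.
  rewrite (bigD1_seq s) //= eqxx mul1r big1 ?addr0 // => i /negbTE->.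
  exact: mul0r.
rewrite -big_seq big_const_seq count_predT iter_addr_0.
rewrite -mulr_natr /b2 /b3.
by rewrite le_eqVlt; apply/orP; left; apply/eqP; ring.
Qed.

End QuadEnergy.

(** * Bounds on the mass and on the correlation of disjoint quadruples *)

Section Correlation.
Variables (R : realFieldType) (T : finType) (a : T -> T -> R).
Local Notation n := #|T|.
Local Notation beta1 := (mass a / (4 * (n ^_ 2)%:R ^+ 2)).
Local Notation beta2 := (disjoint_mass a / (16 * (n ^_ 4)%:R ^+ 2)).
Local Notation beta3 := (mass a ^+ 3 / (64 * (n ^_ 6)%:R ^+ 2)).

(** Elements of even rank serve as [p] and those of odd rank as [q]. The index type is split by
    [lshift] and [rshift] into the halves [A] and [B]. *)
Lemma exists_positions m : (m.*2.*2 <= n)%N -> exists pq : ('I_(m + m) -> T) * ('I_(m + m) -> T),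
  [/\ injective pq.1, injective pq.2 & forall s t, pq.1 s != pq.2 t].
Proof.
move=> mn.
have ltp (s : 'I_(m + m)) : ((val s).*2 < n)%N.
  by apply: leq_trans mn; rewrite ltn_double -addnn ltn_ord.
have ltq (s : 'I_(m + m)) : ((val s).*2.+1 < n)%N.
  by apply: leq_trans mn; rewrite -doubleS leq_double -addnn ltn_ord.
exists (fun s => enum_val (Ordinal (ltp s)), fun s => enum_val (Ordinal (ltq s))).
split=> [s t /enum_val_inj[/double_inj/val_inj //]|s t /enum_val_inj[/double_inj/val_inj //]|].
by move=> s t; apply/negP => /eqP/enum_val_inj[] /(congr1 odd); rewrite /= !odd_double.
Qed.

Hypothesis n_ge6 : (6 <= n)%N.

Lemma mass_bound m : (m.*2.*2 <= n)%N ->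
  m%:R * beta1 <= (\sum_pi lin a pi ^+ 2) / n`!%:R.
Proof.
move=> mn; have [[p q] /= [p_inj q_inj pq]] := exists_positions mn.
pose A := [seq lshift m i | i <- enum 'I_m].
have uA : uniq A by rewrite map_inj_uniq ?enum_uniq //; apply: lshift_inj.
have sA : size A = m by rewrite size_map size_enum_ord.
have n0 : 0 < n`!%:R :> R by rewrite ltr0n fact_gt0.
have := sum_sqr_ge_energy (@swap_pos_inj _ _ p q) (@half_mixed_odd _ _ a _ p q)
  (@half_mixed_even _ _ a _ p q p_inj q_inj pq) (lin_swap a pq) uA.
rewrite sum_energy // sA (sum_pair_perm (fun pi => lin a pi ^+ 2)).
by rewrite expr2 -mulrA ler_pM2l // [X in X <= _]mulrC ler_pdivlMr.
Qed.

(** This is [energy_product] for two halves of size [m]. Its two third-order terms get the same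
    bound, which turns [3 / L] into [6 / L]. *)
Lemma correlation_bound m (f : {perm T} -> R) (L : R) : (m.*2.*2 <= n)%N ->
  (forall i i' j j', `|mixed a i i' j j'| <= 4) -> 1 <= L ->
  (forall pi, f pi ^+ 2 = 1) ->
  m%:R ^+ 2 * beta2 <= 4 * L ^+ 2 * ((\sum_pi (f pi - lin a pi) ^+ 2) / n`!%:R)
    + 6 / L * (m%:R ^+ 3 * beta3 + m%:R ^+ 2 * (4 * beta2)).
Proof.
move=> mn a4 L1 f1; have [[p q] /= [p_inj q_inj pq]] := exists_positions mn.
pose A := [seq lshift m i | i <- enum 'I_m].
pose B := [seq rshift m i | i <- enum 'I_m].
have uA : uniq A by rewrite map_inj_uniq ?enum_uniq //; apply: lshift_inj.
have uB : uniq B by rewrite map_inj_uniq ?enum_uniq //; apply: rshift_inj.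
have sA : size A = m by rewrite size_map size_enum_ord.
have sB : size B = m by rewrite size_map size_enum_ord.
have BA : {in B, forall s, s \notin A}.
  move=> _ /mapP[i _ ->]; apply/negP => /mapP[j _] /eqP.
  by rewrite eq_rlshift.
have AB : {in A, forall s, s \notin B} by move=> s sA'; apply/negP => /BA; rewrite sA'.
have n0 : 0 < n`!%:R :> R by rewrite ltr0n fact_gt0.
have nn0 : 0 < n`!%:R ^+ 2 :> R by rewrite exprn_gt0.
have := energy_product (@swap_pos_inj _ _ p q) (@half_mixed_odd _ _ a _ p q)
  (@half_mixed_even _ _ a _ p q p_inj q_inj pq) (lin_swap a pq) L1
  (fun w => f1 (pair_perm w)) uA uB BA.
rewrite big_split /= sum_energy_energy // sA sB.
rewrite (sum_pair_perm (fun pi => (f pi - lin a pi) ^+ 2)).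
have h1 := sum_energy2_energy_le p_inj q_inj pq n_ge6 a4 uA BA.
have h2 := sum_energy2_energy_le p_inj q_inj pq n_ge6 a4 uB AB.
pose W := flip_energy (half_mixed a p q).
have swW : \sum_w W B w ^+ 2 * W A w = \sum_w W A w * W B w ^+ 2.
  by apply: eq_bigr => w _; rewrite mulrC.
rewrite /W in swW; rewrite swW in h2.
rewrite sA sB in h1 h2.
have L0 : 0 <= 3 / L by rewrite divr_ge0 //; lra.
move=> h; rewrite -(ler_pM2l nn0).
have {}h := le_trans h (lerD (lexx _) (ler_wpM2l L0 (lerD h1 h2))).
rewrite -expr2 in h; apply: le_trans h _.
rewrite le_eqVlt; apply/orP; left; apply/eqP; field.
by rewrite !ffact_neq0 //= (gt_eqF n0) /= lt0r_neq0 //; lra.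
Qed.

End Correlation.

(** * Projection and Poincare inequality *)

Section Degree1.
Variables (R : realFieldType) (T : finType).
Local Notation n := #|T|.
Implicit Types (a b : T -> T -> R).

(** Cauchy-Schwarz, read off from the nonnegative double sum of [(h i - h j) ^+ 2]. *)
Lemma sqr_sum_le (I : finType) (P : pred I) (h : I -> R) :
  (\sum_(i | P i) h i) ^+ 2 <= #|P|%:R * \sum_(i | P i) h i ^+ 2.
Proof.
set S := \sum_(i | P i) h i; set S2 := \sum_(i | P i) h i ^+ 2.
have : 0 <= \sum_(i | P i) \sum_(j | P j) (h i - h j) ^+ 2.
  by apply: sumr_ge0 => i _; apply: sumr_ge0 => j _; apply: sqr_ge0.
have -> : \sum_(i | P i) \sum_(j | P j) (h i - h j) ^+ 2
    = \sum_(i | P i) (#|P|%:R * h i ^+ 2 + S2 - 2 * (h i * S)).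
  apply: eq_bigr => i _.
  rewrite (eq_bigr (fun j => h i ^+ 2 + h j ^+ 2 - 2 * (h i * h j))) => [|j _]; last by ring.
  by rewrite sumrB big_split /= sumr_const mulr_natl -!mulr_sumr.
rewrite sumrB big_split /= sumr_const -!mulr_sumr -mulr_suml -/S -/S2 -[S2 *+ _]mulr_natl.
rewrite expr2; lra.
Qed.

Lemma sum_neq (h : T -> R) x : \sum_(y | y != x) h y = (\sum_y h y) - h x.
Proof. by rewrite [in RHS](bigD1 x) //= addrC addrK. Qed.

Section Projection.
Variables (a : T -> T -> R) (f : {perm T} -> R).
Hypothesis f1 : forall pi, f pi ^+ 2 = 1.
Hypothesis f_proj : forall i j, \sum_pi (f pi - lin a pi) * (pi i == j)%:R = 0.
Hypothesis n_ge2 : (2 <= n)%N.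

(** Given [pi i = j], the image of any other row is uniform on the columns other than [j]. *)
Lemma sum_lin_coset i j :
  (n * n.-1)%:R * (\sum_pi lin a pi * (pi i == j)%:R) = n`!%:R *
    (n%:R * a i j + \sum_x \sum_y a x y - \sum_y a i y - \sum_x a x j).
Proof.
have -> : \sum_pi lin a pi * (pi i == j)%:R
    = \sum_x \sum_(pi : {perm T}) a x (pi x) * (pi i == j)%:R.
  by rewrite exchange_big; apply: eq_bigr => pi _; rewrite mulr_suml.
rewrite (bigD1 i) //= mulrDr.
have -> : (n * n.-1)%:R * (\sum_(pi : {perm T}) a i (pi i) * (pi i == j)%:R)
    = n`!%:R * (n.-1%:R * a i j).
  rewrite natrM mulrAC (sum_perm1 (fun u => a i u * (u == j)%:R)).
  rewrite (bigD1 j) //= eqxx mulr1 big1 ?addr0 => [|u /negbTE->]; first by ring.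
  by rewrite mulr0.
rewrite mulr_sumr (eq_bigr (fun x => n`!%:R * ((\sum_y a x y) - a x j))) => [|x xi].
  rewrite -mulr_sumr -mulrDr; congr (_ * _).
  rewrite sum_neq sumrB.
  have -> : n%:R = n.-1%:R + 1 :> R by rewrite natr1 prednK // (leq_trans _ n_ge2).
  ring.
rewrite -sum_neq (eq_bigr (fun pi : {perm T} => (pi i == j)%:R * a x (pi x))) => [|pi _]; last exact: mulrC.
rewrite (sum_perm2 (fun u v => (u == j)%:R * a x v)) 1?eq_sym //; congr (_ * _).
rewrite (bigD1 j) //= eqxx [X in _ + X]big1 ?addr0.
  by apply: eq_bigr => y _; rewrite mul1r.
by move=> u /negbTE->; rewrite big1 // => v _; rewrite mul0r.
Qed.

(** By orthogonality [lin a] and [f] have the same sum over each coset, at most [n! / n] in absolute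
    value. In a mixed difference of these sums the row and column sums of [sum_lin_coset] cancel,
    leaving a multiple of that of [a]. *)
Lemma mixed_le4 i i' j j' : `|mixed a i i' j j'| <= 4.
Proof.
pose g x y := \sum_pi lin a pi * (pi x == y)%:R.
have n1 : 0 < n.-1%:R :> R by rewrite ltr0n; case: n n_ge2 => [|[]].
have n0 : 0 < n%:R :> R by rewrite ltr0n (leq_trans _ n_ge2).
have nf0 : 0 < n`!%:R :> R by rewrite ltr0n fact_gt0.
have nn : n%:R = n.-1%:R + 1 :> R by rewrite natr1 prednK // (leq_trans _ n_ge2).
have g_le x y : `|n%:R * g x y| <= n`!%:R.
  have -> : g x y = \sum_pi f pi * (pi x == y)%:R.
    have := f_proj x y; under eq_bigr do rewrite mulrBl.
    by rewrite sumrB => /eqP; rewrite subr_eq0 => /eqP->.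
  rewrite normrM ger0_norm ?ler0n //.
  apply: le_trans (_ : n%:R * \sum_(pi : {perm T}) (pi x == y)%:R <= _).
    rewrite ler_wpM2l ?ler0n //; apply: le_trans (ler_norm_sum _ _ _) _.
    apply: ler_sum => pi _; rewrite normrM normr_nat ler_piMl //.
    by rewrite -(expr_le1 (n := 2)) // real_normK ?num_real // f1.
  rewrite (sum_perm1 (fun u => (u == y)%:R)) (bigD1 y) //= eqxx big1 ?addr0 ?mulr1 //.
  by move=> u /negbTE->.
have gE x y := sum_lin_coset x y.
have mE : n%:R * n.-1%:R * (g i j + g i' j' - g i j' - g i' j)
     = n`!%:R * (n%:R * mixed a i i' j j').
  rewrite -natrM !mulrBr mulrDr !gE /mixed; ring.
have : `|n%:R * n`!%:R * mixed a i i' j j'| <= 4 * (n%:R * n`!%:R).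
  have -> : n%:R * n`!%:R * mixed a i i' j j'
     = n.-1%:R * (n%:R * g i j + n%:R * g i' j' - n%:R * g i j' - n%:R * g i' j).
    transitivity (n`!%:R * (n%:R * mixed a i i' j j')); first by ring.
    by rewrite -mE; ring.
  rewrite normrM ger0_norm ?ler0n //.
  apply: le_trans (_ : n.-1%:R * (4 * n`!%:R) <= _).
    rewrite ler_wpM2l ?ler0n //.
    have := g_le i j; have := g_le i' j'; have := g_le i j'; have := g_le i' j.
    rewrite !ler_norml => /andP[? ?] /andP[? ?] /andP[? ?] /andP[? ?]; apply/andP; split; lra.
  by rewrite nn; have := mulr_ge0 (ltW n1) (ltW nf0); lra.
rewrite normrM (gtr0_norm (mulr_gt0 n0 nf0)) [leRHS]mulrC.
by rewrite ler_pM2l ?mulr_gt0.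
Qed.

End Projection.

(* For a doubly centred [b] the off-diagonal terms contribute [1 / (n - 1)] of the
   diagonal ones. *)
Lemma sum_lin_sqr b : (2 <= n)%N ->
  (forall i, \sum_j b i j = 0) -> (forall j, \sum_i b i j = 0) ->
  n.-1%:R * (\sum_pi lin b pi ^+ 2) = n`!%:R * \sum_i \sum_j b i j ^+ 2.
Proof.
move=> n2 row0 col0.
have n0 : n%:R != 0 :> R by rewrite pnatr_eq0 -lt0n (leq_trans _ n2).
apply: (mulfI n0).
have -> : \sum_pi lin b pi ^+ 2
    = \sum_i \sum_i' \sum_(pi : {perm T}) b i (pi i) * b i' (pi i').
  under [RHS]eq_bigr do rewrite exchange_big.
  rewrite [RHS]exchange_big; apply: eq_bigr => pi _ /=.
  by rewrite expr2 mulr_suml; apply: eq_bigr => i _; rewrite mulr_sumr.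
rewrite mulrA -natrM mulr_sumr mulrA mulr_sumr; apply: eq_bigr => i _.
rewrite (_ : \sum_j b i j ^+ 2 = \sum_j b i j * b i j); last first.
  by apply: eq_bigr => j _; rewrite expr2.
rewrite (bigD1 i) //= mulrDr natrM mulrAC.
rewrite (sum_perm1 (fun u => b i u * b i u)) -natrM [X in _ + X]mulr_sumr.
rewrite [X in _ + X](eq_bigr (fun i' => n`!%:R * - \sum_u b i u * b i' u)) => [|i' ii'].
  rewrite -mulr_sumr sumrN [X in _ * - X]exchange_big /=.
  rewrite [X in _ * - X](eq_bigr (fun u => - (b i u * b i u))) => [|u _].
    rewrite sumrN opprK.
    have -> : n%:R = n.-1%:R + 1 :> R by rewrite natr1 prednK // (leq_trans _ n2).
    by ring.
  by rewrite -mulr_sumr sum_neq col0 sub0r mulrN.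
rewrite (sum_perm2 (fun u v => b i u * b i' v)) 1?eq_sym //; congr (_ * _).
rewrite -sumrN; apply: eq_bigr => u _.
by rewrite -mulr_sumr sum_neq row0 sub0r mulrN.
Qed.

(* [b] is [a] doubly centred over the rows in [P]; it is an average of mixed
   differences, so its norm is bounded by Cauchy-Schwarz. *)
Lemma poincare a (P : pred T) : (2 <= n)%N -> (0 < #|P|)%N ->
  exists K (v : T -> R), n.-1%:R * (#|P| * n)%:R *
    (\sum_pi (lin a pi - (K + \sum_(i | ~~ P i) (a i (pi i) - v (pi i)))) ^+ 2)
    <= n`!%:R * \sum_(Q : T * T * (T * T) | P Q.1.1 && P Q.1.2) quadE a Q.
Proof.
move=> n2 P0; set c : R := (#|P| * n)%:R.
have n0 : (0 < n)%N by rewrite (leq_trans _ n2).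
have c0 : 0 < c by rewrite ltr0n muln_gt0 P0.
pose b i j := if P i then c^-1 * \sum_(x | P x) \sum_y mixed a i x j y else 0.
have anti (F : T -> T -> R) (D : pred T) : (forall x y, F x y = - F y x) ->
    \sum_(x | D x) \sum_(y | D y) F x y = 0.
  move=> Fa; set S := \sum_(x | _) _; suff: S = - S by lra.
  rewrite {1}/S exchange_big -sumrN; apply: eq_bigr => x _.
  by rewrite -sumrN; apply: eq_bigr.
have row0 i : \sum_j b i j = 0.
  rewrite /b; case: (P i); last by rewrite big1.
  rewrite -mulr_sumr exchange_big big1 ?mulr0 // => x _.
  by apply: anti => j y; rewrite /mixed; ring.
have col0 j : \sum_i b i j = 0.
  rewrite /b -big_mkcond -mulr_sumr anti ?mulr0 // => i x.
  by rewrite -sumrN; apply: eq_bigr => y _; rewrite /mixed; ring.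
pose u i := c^-1 * (#|P|%:R * (\sum_y a i y) - \sum_(x | P x) \sum_y a x y).
pose v j := c^-1 * (n%:R * \sum_(x | P x) a x j).
have abuv i j : P i -> a i j = b i j + u i + v j.
  move=> Pi; rewrite /b Pi /u /v -!mulrDr; apply: (mulfI (lt0r_neq0 c0)).
  rewrite mulVKf ?lt0r_neq0 //.
  have -> : \sum_(x | P x) \sum_y mixed a i x j y
     = c * a i j + (\sum_(x | P x) \sum_y a x y) - #|P|%:R * (\sum_y a i y)
       - n%:R * (\sum_(x | P x) a x j).
    have inner x : \sum_y mixed a i x j y
       = n%:R * a i j + \sum_y a x y - \sum_y a i y - n%:R * a x j.
      by rewrite /mixed !sumrB big_split /= !sumr_const !mulr_natl.
    rewrite (eq_bigr _ (fun x _ => inner x)) !sumrB big_split /= !sumr_const -mulr_sumr.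
    rewrite -[X in X + _ - _ - _]mulr_natl -[X in _ - X - _]mulr_natl /c natrM; ring.
  by ring.
(* The sum of [v (pi i)] over the rows in [P] is the constant [\sum_j v j] minus the other rows;
   hence those rows carry [a - v]. *)
exists (\sum_(i | P i) u i + \sum_j v j), v.
have lE pi : lin a pi - (\sum_(i | P i) u i + \sum_j v j
    + \sum_(i | ~~ P i) (a i (pi i) - v (pi i))) = lin b pi.
  have -> : \sum_j v j = \sum_i v (pi i) by rewrite (reindex_inj (@perm_inj _ pi)).
  rewrite /lin (bigID P) /= [\sum_i v _](bigID P) /= [RHS](bigID P) /=.
  rewrite [X in _ = _ + X]big1 => [|i /negbTE Pi]; last by rewrite /b Pi.
  rewrite sumrB (eq_bigr _ (fun i Pi => abuv i (pi i) Pi)) !big_split /=; ring.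
under eq_bigr do rewrite lE.
rewrite mulrAC sum_lin_sqr // mulrAC -mulrA ler_wpM2l ?ler0n //.
have -> : \sum_(Q : T * T * (T * T) | P Q.1.1 && P Q.1.2) quadE a Q
   = \sum_(i | P i) \sum_j \sum_(x | P x) \sum_y mixed a i x j y ^+ 2.
  under [RHS]eq_bigr do rewrite exchange_big.
  rewrite [RHS]pair_big /=; under [RHS]eq_bigr do rewrite pair_big.
  rewrite [RHS]pair_big /=; apply: eq_big => // Q.
  by rewrite andbT.
rewrite [X in _ * X](bigID P) /= [X in _ + X]big1 ?addr0; last first.
  by move=> i /negbTE Pi; rewrite big1 // => j _; rewrite /b Pi expr0n.
rewrite mulr_sumr; apply: ler_sum => i Pi; rewrite mulr_sumr; apply: ler_sum => j _.
rewrite /b Pi exprMn expr2 !mulrA mulfV ?lt0r_neq0 // mul1r.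
rewrite -mulrA -expr2 ler_pdivrMl //.
apply: le_trans (sqr_sum_le _ _) _; rewrite /c natrM -mulrA ler_wpM2l ?ler0n //.
rewrite mulr_sumr; apply: ler_sum => x _.
by apply: le_trans (sqr_sum_le _ _) _.
Qed.

End Degree1.

(** * Concentration on a line *)

Section Lines.
Variables (R : realFieldType) (T : finType).
Local Notation n := #|T|.
Local Notation quad := (T * T * (T * T))%type.
Implicit Types (a : T -> T -> R) (Q : quad).

Definition transpose a := fun i j => a j i.
Definition quad_swap Q : quad := (Q.2, Q.1).
Definition through r Q := (Q.1.1 == r) || (Q.1.2 == r).
Definition row_mass a r := \sum_(Q | through r Q) quadE a Q.
Definition off_row_mass a r := \sum_(Q | ~~ through r Q) quadE a Q.

Lemma quad_swapK : involutive quad_swap. Proof. by case. Qed.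

Lemma quadE_transpose a Q : quadE (transpose a) Q = quadE a (quad_swap Q).
Proof. by rewrite /quadE /mixed /transpose; ring. Qed.

Lemma mass_transpose a : mass (transpose a) = mass a.
Proof.
rewrite /mass [RHS](reindex_inj (inv_inj quad_swapK)).
by apply: eq_bigr => Q _; rewrite (quadE_transpose a).
Qed.

Lemma disjoint_mass_transpose a : disjoint_mass (transpose a) = disjoint_mass a.
Proof.
rewrite /disjoint_mass [RHS](reindex_inj (inv_inj quad_swapK)).
apply: eq_bigr => Q _; rewrite [RHS](reindex_inj (inv_inj quad_swapK)) /=.
apply: eq_big => [Q'|Q' _]; last by rewrite !(quadE_transpose a).
by rewrite /quad_disjoint andbC.
Qed.

Lemma quadE_eq0 a Q : (Q.1.1 == Q.1.2) || (Q.2.1 == Q.2.2) -> quadE a Q = 0.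
Proof.
by rewrite /quadE => /orP[]/eqP->; rewrite ?mixed_diagl ?mixed_diagr expr0n.
Qed.

(** Some [Q1] of positive energy is disjoint from less than half of the mass, as otherwise summing
    over [Q1] contradicts the hypothesis. The rest of the mass meets one of its two rows or two
    columns, so one of these four lines carries an eighth. *)
Lemma exists_heavy_line a : 0 < mass a -> disjoint_mass a < mass a ^+ 2 / 2 ->
  exists r, (mass a / 8 <= row_mass a r) \/ (mass a / 8 <= row_mass (transpose a) r).
Proof.
move=> m0 dm.
pose N Q1 := \sum_(Q2 | quad_disjoint Q1 Q2) quadE a Q2.
have [/existsP[Q1 /andP[Q10 NQ]]|/existsPn noQ] :=
    boolP [exists Q1, (0 < quadE a Q1) && (N Q1 < mass a / 2)]; last first.
  suff: mass a ^+ 2 / 2 <= disjoint_mass a by lra.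
  rewrite /disjoint_mass expr2 -mulrA mulr_suml; apply: ler_sum => Q1 _.
  rewrite -mulr_sumr; have := noQ Q1; rewrite negb_and -leNgt -leNgt => /orP[Q1le|NQ1].
    have -> : quadE a Q1 = 0 by apply/eqP; rewrite eq_le Q1le quadE_ge0.
    by rewrite !mul0r.
  by rewrite ler_wpM2l ?quadE_ge0.
have Q1nd : (Q1.1.1 != Q1.1.2) && (Q1.2.1 != Q1.2.2).
  by rewrite -negb_or; apply: contraTN Q10 => /(quadE_eq0 a)->; rewrite ltxx.
have : mass a / 2 <= row_mass a Q1.1.1 + row_mass a Q1.1.2
    + row_mass (transpose a) Q1.2.1 + row_mass (transpose a) Q1.2.2.
  have colE c : row_mass (transpose a) c = \sum_(Q | through c (quad_swap Q)) quadE a Q.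
    rewrite /row_mass [RHS](reindex_inj (inv_inj quad_swapK)) /=.
    by apply: eq_big => [Q|Q _]; rewrite ?quad_swapK // (quadE_transpose a).
  apply: le_trans (_ : \sum_(Q2 | ~~ quad_disjoint Q1 Q2) quadE a Q2 <= _).
    have : mass a = N Q1 + \sum_(Q2 | ~~ quad_disjoint Q1 Q2) quadE a Q2.
      by rewrite /mass (bigID (quad_disjoint Q1)).
    by lra.
  rewrite !colE /row_mass big_mkcond [X in X + _ + _ + _]big_mkcond.
  rewrite [X in _ + X + _ + _]big_mkcond [X in _ + X + _]big_mkcond [X in _ + X]big_mkcond.
  rewrite -!big_split; apply: ler_sum => Q _ /=.
  have Q0 := quadE_ge0 a Q.
  have [/(quadE_eq0 a)->|] := boolP ((Q.1.1 == Q.1.2) || (Q.2.1 == Q.2.2)).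
    by rewrite !if_same !addr0.
  rewrite negb_or /quad_disjoint /through /= !inE !negb_or.
  rewrite ![Q.1.1 == Q1.1.1]eq_sym ![Q.1.1 == Q1.1.2]eq_sym ![Q.1.2 == Q1.1.1]eq_sym.
  rewrite ![Q.1.2 == Q1.1.2]eq_sym ![Q.2.1 == Q1.2.1]eq_sym ![Q.2.1 == Q1.2.2]eq_sym.
  rewrite ![Q.2.2 == Q1.2.1]eq_sym ![Q.2.2 == Q1.2.2]eq_sym.
  case/andP: Q1nd => -> -> /andP[-> ->] /=.
  do 8?(case: (_ == _) => //=); lra.
move=> h; have [h1|h1] := lerP (mass a / 8) (row_mass a Q1.1.1); first by exists Q1.1.1; left.
have [h2|h2] := lerP (mass a / 8) (row_mass a Q1.1.2); first by exists Q1.1.2; left.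
have [h3|h3] := lerP (mass a / 8) (row_mass (transpose a) Q1.2.1).
  by exists Q1.2.1; right.
exists Q1.2.2; right; lra.
Qed.

(** Applied where [P] prescribes two coordinates and [g] reads the other two. *)
Lemma card_two_fixed (P : pred quad) (g : quad -> T * T) :
  {in P &, injective g} -> (#|P| <= n * n)%N.
Proof.
by move=> /card_in_image <-; rewrite -card_prod; apply: max_card.
Qed.

Ltac two_fixed :=
  move=> [[? ?] [? ?]] [[? ?] [? ?]];
  rewrite !unfold_in /= => /andP[/eqP-> /eqP->] /andP[/eqP-> /eqP->] [] //;
  by move=> -> ->.

(* [192 = 12 * 16]: at most [12 * n ^ 2] quadruples through [r] meet a given one that
   avoids [r]. *)
Lemma off_row_bound a r : (forall Q, quadE a Q <= 16) ->
  off_row_mass a r * (row_mass a r - 192 * n%:R ^+ 2) <= disjoint_mass a.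
Proof.
move=> a16; rewrite /off_row_mass mulr_suml /disjoint_mass.
apply: le_trans (_ : \sum_(Q1 | ~~ through r Q1)
    \sum_(Q2 | quad_disjoint Q1 Q2) quadE a Q1 * quadE a Q2 <= _); last first.
  rewrite [leRHS](bigID (through r)) /= lerDr.
  by apply: sumr_ge0 => Q _; apply: sumr_ge0 => Q' _; rewrite mulr_ge0 // quadE_ge0.
apply: ler_sum => Q1 Q1r; rewrite -mulr_sumr.
have [/(quadE_eq0 a)->|Q1nd] := boolP ((Q1.1.1 == Q1.1.2) || (Q1.2.1 == Q1.2.2)).
  by rewrite !mul0r.
rewrite ler_wpM2l ?quadE_ge0 //.
(* As [Q1] avoids [r], the coincidence with [Q1] occurs at a coordinate other than the one equal to
   [r]: two places for [r], and for each two coincidences of rows and four of columns. *)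
pose Ps : seq (pred quad) := [::
  fun Q => (Q.1.1 == r) && (Q.1.2 == Q1.1.1); fun Q => (Q.1.1 == r) && (Q.1.2 == Q1.1.2);
  fun Q => (Q.1.1 == r) && (Q.2.1 == Q1.2.1); fun Q => (Q.1.1 == r) && (Q.2.1 == Q1.2.2);
  fun Q => (Q.1.1 == r) && (Q.2.2 == Q1.2.1); fun Q => (Q.1.1 == r) && (Q.2.2 == Q1.2.2);
  fun Q => (Q.1.2 == r) && (Q.1.1 == Q1.1.1); fun Q => (Q.1.2 == r) && (Q.1.1 == Q1.1.2);
  fun Q => (Q.1.2 == r) && (Q.2.1 == Q1.2.1); fun Q => (Q.1.2 == r) && (Q.2.1 == Q1.2.2);
  fun Q => (Q.1.2 == r) && (Q.2.2 == Q1.2.1); fun Q => (Q.1.2 == r) && (Q.2.2 == Q1.2.2)].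
have meet_le : \sum_(Q | through r Q && ~~ quad_disjoint Q1 Q) quadE a Q <= 192 * n%:R ^+ 2.
  apply: le_trans (_ : \sum_Q \sum_(P <- Ps) 16 * (P Q : bool)%:R <= _).
    rewrite big_mkcond; apply: ler_sum => Q _.
    have sum0 : 0 <= \sum_(P <- Ps) 16 * (P Q : bool)%:R :> R.
      by apply: sumr_ge0 => P _; rewrite mulr_ge0 ?ler0n.
    case: ifP => // /andP[Qr Qd].
    have [/(quadE_eq0 a)->//|Qnd] := boolP ((Q.1.1 == Q.1.2) || (Q.2.1 == Q.2.2)).
    apply: le_trans (a16 Q) _; rewrite -mulr_sumr ler_peMr ?ler0n //.
    suff hasP : has (fun P : pred quad => P Q) Ps.
      rewrite -natr_sum (ler_nat _ 1) (_ : \sum_(P <- Ps) _ = count (fun P : pred quad => P Q) Ps).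
        by rewrite -has_count.
      by rewrite -sum1_count [RHS]big_mkcond; apply: eq_bigr => P _; case: (P Q).
    move: Qd Qr Q1r; rewrite /quad_disjoint /through /= !inE !negb_or.
    move: Q1nd Qnd; rewrite !negb_or => /andP[-> ->] /andP[-> ->] /=.
    rewrite ![Q.1.1 == Q1.1.1]eq_sym ![Q.1.1 == Q1.1.2]eq_sym ![Q.1.2 == Q1.1.1]eq_sym.
    rewrite ![Q.1.2 == Q1.1.2]eq_sym ![Q.2.1 == Q1.2.1]eq_sym ![Q.2.1 == Q1.2.2]eq_sym.
    rewrite ![Q.2.2 == Q1.2.1]eq_sym ![Q.2.2 == Q1.2.2]eq_sym.
    have [e|_] := eqVneq Q.1.1 r; have [e'|_] := eqVneq Q.1.2 r => //=;
      rewrite ?e ?e'; do 12?(case: (_ == _) => //=).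
  have cardP (P : pred quad) (g : quad -> T * T) : {in P &, injective g} ->
      \sum_Q 16 * (P Q : bool)%:R <= 16 * n%:R ^+ 2 :> R.
    move=> g_inj; have Pn := card_two_fixed g_inj; rewrite -mulr_sumr ler_wpM2l ?ler0n // -natr_sum -natrX.
    rewrite ler_nat -mulnn; apply: leq_trans Pn.
    by rewrite -sum1_card [leqRHS]big_mkcond; apply: leq_sum => Q _; rewrite unfold_in; case: (P Q).
  under eq_bigr do rewrite /Ps !big_cons big_nil.
  rewrite !big_split /= big1_eq.
  have -> : 192 * n%:R ^+ 2 = 16 * n%:R ^+ 2 + (16 * n%:R ^+ 2 + (16 * n%:R ^+ 2 +
    (16 * n%:R ^+ 2 + (16 * n%:R ^+ 2 + (16 * n%:R ^+ 2 + (16 * n%:R ^+ 2 +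
    (16 * n%:R ^+ 2 + (16 * n%:R ^+ 2 + (16 * n%:R ^+ 2 + (16 * n%:R ^+ 2 +
    (16 * n%:R ^+ 2 + 0))))))))))) :> R by ring.
  apply: lerD; first by apply: (cardP _ (fun Q => Q.2)); two_fixed.
  apply: lerD; first by apply: (cardP _ (fun Q => Q.2)); two_fixed.
  apply: lerD; first by apply: (cardP _ (fun Q => (Q.1.2, Q.2.2))); two_fixed.
  apply: lerD; first by apply: (cardP _ (fun Q => (Q.1.2, Q.2.2))); two_fixed.
  apply: lerD; first by apply: (cardP _ (fun Q => (Q.1.2, Q.2.1))); two_fixed.
  apply: lerD; first by apply: (cardP _ (fun Q => (Q.1.2, Q.2.1))); two_fixed.
  apply: lerD; first by apply: (cardP _ (fun Q => Q.2)); two_fixed.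
  apply: lerD; first by apply: (cardP _ (fun Q => Q.2)); two_fixed.
  apply: lerD; first by apply: (cardP _ (fun Q => (Q.1.1, Q.2.2))); two_fixed.
  apply: lerD; first by apply: (cardP _ (fun Q => (Q.1.1, Q.2.2))); two_fixed.
  apply: lerD; first by apply: (cardP _ (fun Q => (Q.1.1, Q.2.1))); two_fixed.
  apply: lerD; first by apply: (cardP _ (fun Q => (Q.1.1, Q.2.1))); two_fixed.
  by [].
have -> : row_mass a r = \sum_(Q | through r Q && quad_disjoint Q1 Q) quadE a Q
   + \sum_(Q | through r Q && ~~ quad_disjoint Q1 Q) quadE a Q.
  by rewrite /row_mass (bigID (quad_disjoint Q1)).
apply: le_trans (_ : \sum_(Q | through r Q && quad_disjoint Q1 Q) quadE a Q <= _).
  by rewrite lerBlDr lerD2l.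
rewrite [leRHS](bigID (through r)) /= (eq_bigl _ _ (fun Q => andbC _ _)) lerDl.
by apply: sumr_ge0 => Q _; apply: quadE_ge0.
Qed.

End Lines.

(** * Quantitative bounds *)

Section Structure.
Variables (R : realFieldType) (T : finType).
Local Notation n := #|T|.
Local Notation x := (n%:R : R).
Local Notation Nf := (n`!%:R : R).
Implicit Types (a : T -> T -> R) (F : {set {perm T}}) (f : {perm T} -> R).

Definition signf F : {perm T} -> R := fun pi => 2 * (pi \in F)%:R - 1.

Lemma signf_sqr F pi : signf F pi ^+ 2 = 1.
Proof. by rewrite /signf; case: (pi \in F) => /=; ring. Qed.

Lemma fact_gt0R : 0 < Nf. Proof. by rewrite ltr0n fact_gt0. Qed.

Lemma sum_dist_split (u v w : {perm T} -> R) :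
  \sum_pi (u pi - w pi) ^+ 2
    <= 2 * (\sum_pi (u pi - v pi) ^+ 2) + 2 * (\sum_pi (v pi - w pi) ^+ 2).
Proof.
rewrite !mulr_sumr -big_split; apply: ler_sum => pi _ /=.
have := sqr_ge0 (u pi - v pi - (v pi - w pi)); lra.
Qed.

Lemma sum_perm_const (k : R) : \sum_(pi : {perm T}) k = Nf * k.
Proof.
rewrite sumr_const mulr_natl -[X in X`!]cardsT -card_Sym; congr (_ *+ _).
by apply: eq_card => s; rewrite [RHS]inE; apply/esym/subsetP => y; rewrite inE.
Qed.

(** The mean of [signf F] is [2 * c - 1] and its variance [4 * c * (1 - c)]; another centre [K] only
    adds the square of its distance to the mean. *)
Lemma signf_variance F (c K : R) : #|F|%:R = c * Nf ->
  4 * (c * (1 - c)) * Nf <= \sum_pi (signf F pi - K) ^+ 2.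
Proof.
move=> Fc.
rewrite (eq_bigr (fun pi => (1 + K) ^+ 2 - 4 * K * (pi \in F)%:R)) => [|pi _]; last first.
  by rewrite /signf; case: (pi \in F) => /=; ring.
rewrite sumrB sum_perm_const -mulr_sumr -natr_sum.
have -> : (\sum_(pi : {perm T}) (pi \in F) = #|F|)%N.
  by rewrite -sum1_card [RHS]big_mkcond; apply: eq_bigr => pi _; case: (pi \in F).
rewrite Fc.
have := mulr_ge0 (ltW fact_gt0R) (sqr_ge0 (K - (2 * c - 1))); lra.
Qed.

(** With all rows in [P], [poincare] bounds the distance from [lin a] to a constant by the mass.
    This distance cannot be small, since [signf F] has variance at least [2 * eta] and is close to
    [lin a]. *)
Lemma mass_lower a F (c eta : R) : (2 <= n)%N -> #|F|%:R = c * Nf ->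
  0 < eta -> eta <= c -> eta <= 1 - c ->
  \sum_pi (signf F pi - lin a pi) ^+ 2 <= eta / 2 * Nf ->
  eta * x ^+ 3 / 4 <= mass a.
Proof.
move=> n2 Fc eta0 ec ec' eps.
have n0 : (0 < #|@predT T|)%N by rewrite (leq_trans _ n2).
have [K [v Kv]] := @poincare R T a predT n2 n0.
rewrite (eq_bigr (fun pi => (lin a pi - K) ^+ 2)) in Kv; last first.
  by move=> pi _; rewrite big1 ?addr0 // => i; rewrite /=.
have := signf_variance K Fc; have := sum_dist_split (signf F) (lin a) (fun=> K).
set S1 := \sum_pi (lin a pi - K) ^+ 2 in Kv * => h1 h2.
have x2 : 2 <= x by rewrite (ler_nat _ 2).
have xE : n.-1%:R = x - 1 :> R by rewrite -subn1 natrB // (leq_trans _ n2).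
have massE : \sum_(Q : T * T * (T * T) | predT Q.1.1 && predT Q.1.2) quadE a Q = mass a.
  by [].
rewrite massE natrM xE in Kv.
have cc : eta / 2 <= c * (1 - c).
  have [c2|c2] := lerP c (1 / 2).
    by have := mulr_ge0 (_ : 0 <= c - eta) (_ : 0 <= 1 - c - 1/2); nra.
  by have := mulr_ge0 (_ : 0 <= 1 - c - eta) (_ : 0 <= c - 1/2); nra.
have N0 := fact_gt0R.
have S1le : eta / 2 * Nf <= S1.
  have := ler_wpM2r (ltW N0) cc; lra.
have x3 : 0 <= (x - 1) * (x * x) by rewrite !mulr_ge0 ?ler0n //; lra.
have M1 : (x - 1) * (x * x) * (eta / 2) <= mass a.
  rewrite -(ler_pM2l N0); apply: le_trans Kv.
  rewrite -/x; have := ler_wpM2l x3 S1le; lra.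
apply: le_trans M1.
have : 0 <= (x - 2) * (x * x) * eta by rewrite !mulr_ge0 ?ler0n ?subr_ge0 // ltW.
lra.
Qed.

Lemma ffact_le_exp j : (n ^_ j)%:R <= x ^+ j.
Proof.
rewrite -natrX ler_nat; elim: j => [|j IH]; first by rewrite ffactn0.
by rewrite ffactnSr expnSr leq_mul // leq_subr.
Qed.

(** The first factor is [n]; each later one is [n - i] with [i <= 5], at least [n / 2]. *)
Lemma ffact_ge_exp j : (10 <= n)%N -> (j <= 6)%N -> x ^+ j <= 2 ^+ j.-1 * (n ^_ j)%:R.
Proof.
move=> n10; elim: j => [|[|j] IH] j6; first by rewrite ffactn0 mulr1.
  by rewrite ffactn1 mul1r.
rewrite exprSr [2 ^+ _]exprSr ffactnSr natrM.
have {}IH := IH (ltnW j6).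
have h : x <= 2 * (n - j.+1)%:R.
  have : (n <= 2 * (n - j.+1))%N by lia.
  by rewrite -(ler_nat R) natrM.
apply: le_trans (ler_pM _ _ IH h) _; rewrite ?exprn_ge0 ?ler0n //.
by rewrite le_eqVlt /=; apply/orP; left; apply/eqP; ring.
Qed.

(** The second moment of [lin a] is at most 4, and [mass_bound] is applied with [m] between [n / 8]
    and [n / 4]. *)
Lemma mass_upper a f e : (10 <= n)%N -> (forall pi, f pi ^+ 2 = 1) -> e <= 1 ->
  \sum_pi (f pi - lin a pi) ^+ 2 <= e * Nf -> mass a <= 128 * x ^+ 3.
Proof.
move=> n10 f1 e1 eps; set m := (n %/ 4)%N.
have mn : (m.*2.*2 <= n)%N by rewrite /m; lia.
have nm : (n <= 8 * m)%N by rewrite /m; lia.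
have := @mass_bound R T a (leq_trans (isT : 6 <= 10)%N n10) m mn.
have N0 := fact_gt0R.
have : (\sum_pi lin a pi ^+ 2) / Nf <= 4.
  rewrite ler_pdivrMr //.
  have := sum_dist_split (fun=> 0) f (lin a).
  rewrite (eq_bigr (fun pi => lin a pi ^+ 2)) => [|pi _]; last by rewrite sub0r sqrrN.
  rewrite [X in 2 * X + _](eq_bigr (fun=> 1)) => [|pi _]; last by rewrite sub0r sqrrN.
  rewrite sum_perm_const mulr1.
  have := ler_wpM2r (ltW N0) e1; lra.
move=> h1 h2; have {h1 h2} := le_trans h2 h1.
have x0 : 0 < x by rewrite ltr0n (leq_trans _ n10).
have f2 : 0 < (n ^_ 2)%:R :> R by rewrite ltr0n ffact_gt0 (leq_trans _ n10).
have m0 : 0 < m%:R :> R by rewrite ltr0n /m; lia.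
rewrite mulrA ler_pdivrMr ?mulr_gt0 ?exprn_gt0 // => h.
have f22 : (n ^_ 2)%:R ^+ 2 <= x ^+ 4.
  by rewrite (exprM x 2 2) lerXn2r ?nnegrE ?exprn_ge0 ?ler0n // ffact_le_exp.
have xm : x <= 8 * m%:R by rewrite -(ler_nat R) natrM in nm.
rewrite -(ler_pM2l m0); apply: le_trans h _.
apply: le_trans (_ : 16 * (x * x ^+ 3) <= _); first by rewrite -exprS; lra.
by have := ler_wpM2r (exprn_ge0 3 (ltW x0)) xm; lra.
Qed.

(** [mass_upper] alone bounds this by order [x ^+ 6]. Fed into the error terms of
    [correlation_bound], that crude bound improves itself by the factor [e ^+ 2]. *)
Lemma disjoint_mass_small a f (e : R) : (10 <= n)%N ->
  (forall i i' j j', `|mixed a i i' j j'| <= 4) -> (forall pi, f pi ^+ 2 = 1) ->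
  0 < e -> e <= 1 -> \sum_pi (f pi - lin a pi) ^+ 2 <= e ^+ 7 * Nf ->
  disjoint_mass a <= 2 ^+ 33 * e ^+ 2 * x ^+ 6.
Proof.
move=> n10 a4 f1 e0 e1 eps; set m := (n %/ 4)%N.
have mn : (m.*2.*2 <= n)%N by rewrite /m; lia.
have nm : (n <= 8 * m)%N by rewrite /m; lia.
have mn4 : (4 * m <= n)%N by rewrite /m; lia.
have x0 : 0 < x by rewrite ltr0n (leq_trans _ n10).
have m0 : 0 < m%:R :> R by rewrite ltr0n /m; lia.
have N0 := fact_gt0R.
have e7 : e ^+ 7 <= 1 by rewrite exprn_ile1 // ltW.
have Mu : mass a <= 128 * x ^+ 3 := mass_upper n10 f1 e7 eps.
have M0 := mass_ge0 a.
have L1 : 1 <= (e ^+ 2)^-1 by rewrite invf_ge1 ?exprn_gt0 // exprn_ile1 // ltW.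
have := correlation_bound (leq_trans (isT : 6 <= 10)%N n10) mn a4 L1 f1.
set ep := _ / Nf; set b2 := disjoint_mass a / _; set b3 := _ / (64 * _).
have epe : ep <= e ^+ 7 by rewrite ler_pdivrMr.
have f4 : 0 < (n ^_ 4)%:R :> R by rewrite ltr0n ffact_gt0 (leq_trans _ n10).
have f6 : 0 < (n ^_ 6)%:R :> R by rewrite ltr0n ffact_gt0 (leq_trans _ n10).
have f4x : (x ^+ 4) ^+ 2 <= 64 * (n ^_ 4)%:R ^+ 2.
  have : (x ^+ 4) ^+ 2 <= (8 * (n ^_ 4)%:R) ^+ 2.
    rewrite lerXn2r ?nnegrE ?mulr_ge0 ?exprn_ge0 ?ler0n //.
    apply: le_trans (ffact_ge_exp n10 (isT : 4 <= 6)%N) _.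
    by rewrite ler_wpM2r ?ler0n //; lra.
  by lra.
have f6x : (x ^+ 6) ^+ 2 <= 1024 * (n ^_ 6)%:R ^+ 2.
  have : (x ^+ 6) ^+ 2 <= (32 * (n ^_ 6)%:R) ^+ 2.
    rewrite lerXn2r ?nnegrE ?mulr_ge0 ?exprn_ge0 ?ler0n //.
    apply: le_trans (ffact_ge_exp n10 (isT : 6 <= 6)%N) _.
    by rewrite ler_wpM2r ?ler0n //; lra.
  by lra.
have xm : x <= 8 * m%:R by rewrite -(ler_nat R) natrM in nm.
have mx : 4 * m%:R <= x.
  by rewrite -(ler_nat R) natrM in mn4.
have m2 : 16 * m%:R ^+ 2 <= x ^+ 2.
  have : (4 * m%:R) ^+ 2 <= x ^+ 2 by rewrite lerXn2r ?nnegrE ?mulr_ge0 ?ler0n.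
  by lra.
have m3 : 64 * m%:R ^+ 3 <= x ^+ 3.
  have : (4 * m%:R) ^+ 3 <= x ^+ 3 by rewrite lerXn2r ?nnegrE ?mulr_ge0 ?ler0n.
  by lra.
have K0 : 0 <= disjoint_mass a.
  by apply: sumr_ge0 => Q _; apply: sumr_ge0 => Q' _; rewrite mulr_ge0 ?quadE_ge0.
have Kle : disjoint_mass a <= 2 ^+ 14 * x ^+ 6.
  apply: le_trans (disjoint_mass_le a) _.
  have : mass a ^+ 2 <= (128 * x ^+ 3) ^+ 2.
    by rewrite lerXn2r ?nnegrE ?mulr_ge0 ?exprn_ge0 ?ler0n.
  by lra.
have M3 : mass a ^+ 3 <= 2 ^+ 21 * x ^+ 9.
  have : mass a ^+ 3 <= (128 * x ^+ 3) ^+ 3.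
    by rewrite lerXn2r ?nnegrE ?mulr_ge0 ?exprn_ge0 ?ler0n.
  by lra.
have b2le : m%:R ^+ 2 * (4 * b2) <= 2 ^+ 14.
  rewrite /b2 !mulrA ler_pdivrMr ?mulr_gt0 ?exprn_gt0 //.
  have m20 : 0 <= 16 * m%:R ^+ 2 :> R by rewrite mulr_ge0 ?exprn_ge0 ?ler0n.
  have := ler_pM m20 K0 m2 Kle; lra.
have b3le : m%:R ^+ 3 * b3 <= 2 ^+ 19.
  rewrite /b3 mulrA ler_pdivrMr ?mulr_gt0 ?exprn_gt0 //.
  have m30 : 0 <= 64 * m%:R ^+ 3 :> R by rewrite mulr_ge0 ?exprn_ge0 ?ler0n.
  have := ler_pM m30 (exprn_ge0 3 M0) m3 M3; lra.
(* The truncation level [e ^- 2] balances [L ^+ 2 * e ^+ 7] and [1 / L]. *)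
set L := (e ^+ 2)^-1 in L1 *; rewrite [6 / L](_ : _ = 6 * e ^+ 2); last by rewrite /L invrK.
have -> : 4 * L ^+ 2 * ep = 4 * (L ^+ 2 * ep) by rewrite mulrA.
have Lep : L ^+ 2 * ep <= e ^+ 3.
  rewrite /L exprVn ler_pdivrMl ?exprn_gt0 // -exprM.
  by apply: le_trans epe _; rewrite -exprD.
have e20 : 0 <= e ^+ 2 by rewrite sqr_ge0.
have e3 : e ^+ 3 <= e ^+ 2 by rewrite exprS ler_piMl.
move=> h; have {h} h : m%:R ^+ 2 * b2 <= 2 ^+ 23 * e ^+ 2.
  by have := ler_wpM2l e20 (lerD b3le b2le); lra.
have f4u : (n ^_ 4)%:R ^+ 2 <= x ^+ 8.
  by rewrite (exprM x 4 2) lerXn2r ?nnegrE ?exprn_ge0 ?ler0n // ffact_le_exp.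
have m20 : 0 < m%:R ^+ 2 :> R by rewrite exprn_gt0.
have xm2 : x ^+ 2 <= 64 * m%:R ^+ 2.
  have : x ^+ 2 <= (8 * m%:R) ^+ 2 by rewrite lerXn2r ?nnegrE ?mulr_ge0 ?ler0n.
  by lra.
rewrite -(ler_pM2l m20); move: h.
rewrite /b2 mulrA ler_pdivrMr ?mulr_gt0 ?exprn_gt0 // => h; apply: le_trans h _.
have h1 := ler_wpM2l e20 f4u.
have x60 : 0 <= e ^+ 2 * x ^+ 6 by rewrite mulr_ge0 ?(ltW (exprn_gt0 _ x0)) ?e20.
have h2 := ler_wpM2l x60 xm2.
lra.
Qed.

End Structure.

(** * Dictatorships *)

Section Dictator.
Variables (R : realFieldType) (T : finType).
Local Notation n := #|T|.
Local Notation x := (n%:R : R).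
Local Notation Nf := (n`!%:R : R).
Implicit Types (a : T -> T -> R) (F : {set {perm T}}) (J : {set T}).
Local Notation "A '^^' B" := ((A :\: B) :|: (B :\: A)) (at level 52).

Definition dictator (r : T) J : {set {perm T}} := [set pi : {perm T} | pi r \in J].
Definition inverses F : {set {perm T}} := [set pi : {perm T} | (pi^-1)%g \in F].

Lemma card_inverses F : #|inverses F| = #|F|.
Proof.
rewrite -(card_imset _ (@invg_inj _)); apply: eq_card => pi.
apply/imsetP/idP => [[s] | pF]; first by rewrite inE => sF ->.
by exists (pi^-1)%g; rewrite ?invgK // inE invgK.
Qed.

Lemma lin_transpose a pi : lin (transpose a) pi = lin a (pi^-1)%g.
Proof.
rewrite /lin (reindex_inj (@perm_inj _ pi^-1%g)) /=.
by apply: eq_bigr => i _; rewrite permKV.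
Qed.

(** A heavy row forces little mass off it, by [off_row_bound] and the smallness of [disjoint_mass];
    [poincare] on the remaining rows turns this into L2-closeness. *)
Lemma row_approximation a F (eta e : R) r : (forall Q, quadE a Q <= 16) ->
  disjoint_mass a <= 2 ^+ 33 * e ^+ 2 * x ^+ 6 ->
  eta * x ^+ 3 / 4 <= mass a -> mass a / 8 <= row_mass a r ->
  0 < eta -> eta <= 1 -> 0 < e -> 2 ^+ 20 * e <= eta -> 1 <= e ^+ 3 * x ->
  \sum_pi (signf R F pi - lin a pi) ^+ 2 <= e ^+ 7 * Nf ->
  exists psi : T -> R,
    eta * (\sum_pi (signf R F pi - psi (pi r)) ^+ 2) <= 2 ^+ 43 * e ^+ 2 * Nf.
Proof.
move=> q16 K2 Mlow Mrow eta0 eta1 e0 ee ex eps.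
have e1 : e <= 1 by lra.
have x0 : 0 < x.
  by rewrite -(pmulr_rgt0 _ (exprn_gt0 3 e0)) (lt_le_trans _ ex).
have e31 : e ^+ 3 <= e by rewrite exprS ler_piMr ?exprn_ile1 // ltW.
have ex1 : 1 <= e * x by apply: le_trans ex _; rewrite ler_pM2r.
have etax : 2 ^+ 20 <= eta * x.
  have := ler_wpM2r (ltW x0) ee; have := ex1; lra.
have x2 : 2 <= x by have := ler_wpM2r (ltW x0) eta1; lra.
have n2 : (2 <= n)%N by rewrite (ler_nat R 2) in x2.
have x20 : 0 < x ^+ 2 by rewrite exprn_gt0.
have x30 : 0 < x ^+ 3 by rewrite exprn_gt0.
have off0 : 0 <= off_row_mass a r by apply: sumr_ge0 => Q _; apply: quadE_ge0.
(* The row carries at least [eta * x ^+ 3 / 32], and [etax] lets half of it absorb the loss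
   [192 * x ^+ 2]. *)
have Mr : eta * x ^+ 3 / 64 <= row_mass a r - 192 * x ^+ 2.
  by have := ler_wpM2r (ltW x20) etax; lra.
have off_le : eta * off_row_mass a r <= 2 ^+ 39 * e ^+ 2 * x ^+ 3.
  have := le_trans (off_row_bound r q16) K2.
  have := ler_wpM2l off0 Mr => h1 h2.
  rewrite -(ler_pM2r x30); have := le_trans h1 h2; lra.
have cardr : #|predC1 r| = n.-1 by rewrite cardC1.
have P0 : (0 < #|predC1 r|)%N by rewrite cardr -subn1 subn_gt0.
have [K [v Kv]] := poincare a n2 P0.
(* Only the row [r] lies outside [predC1 r], so the approximant depends on [pi r] alone. *)
exists (fun j => K + (a r j - v j)).
have xE : n.-1%:R = x - 1 :> R by rewrite -subn1 natrB // (leq_trans _ n2).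
rewrite cardr natrM xE in Kv.
have offE : \sum_(Q : T * T * (T * T) | predC1 r Q.1.1 && predC1 r Q.1.2) quadE a Q
    = off_row_mass a r.
  by apply: eq_bigl => Q; rewrite /through negb_or.
rewrite offE in Kv.
rewrite (eq_bigr (fun pi : {perm T} => (lin a pi - (K + (a r (pi r) - v (pi r)))) ^+ 2)) in Kv; last first.
  move=> pi _; rewrite (big_pred1 r) // => i.
  by rewrite /= negbK.
have := sum_dist_split (signf R F) (lin a) (fun pi => K + (a r (pi r) - v (pi r))).
set S1 := \sum_pi (lin a pi - _) ^+ 2 in Kv *.
set S2 := \sum_pi (signf R F pi - (K + _)) ^+ 2 => hS.
have S10 : 0 <= S1 by apply: sumr_ge0 => pi _; apply: sqr_ge0.
have N0 := fact_gt0R R T.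
have xx : x ^+ 3 / 4 <= (x - 1) * ((x - 1) * x).
  have : 0 <= (x - 2) * (3 * x - 2) * x by apply: mulr_ge0 (ltW x0); apply: mulr_ge0; lra.
  lra.
have S1le : eta * S1 <= 2 ^+ 41 * e ^+ 2 * Nf.
  have h1 := le_trans (ler_wpM2r S10 xx) Kv.
  have h2 := ler_wpM2l (ltW eta0) h1.
  have h3 := ler_wpM2l (ltW N0) off_le.
  rewrite -(ler_pM2l x30); lra.
have e72 : e ^+ 7 <= e ^+ 2.
  by rewrite (exprD e 5 2) ler_piMl ?sqr_ge0 // exprn_ile1 // ltW.
have h4 : eta * (e ^+ 7 * Nf) <= e ^+ 2 * Nf.
  rewrite -[leRHS]mul1r ler_pM ?(ltW eta0) ?mulr_ge0 ?exprn_ge0 ?ler0n ?(ltW e0) //.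
  by rewrite ler_pM2r.
have h5 := ler_wpM2l (ltW eta0) hS.
have h6 := ler_wpM2l (ltW eta0) eps.
have : 0 <= e ^+ 2 * Nf by rewrite mulr_ge0 ?sqr_ge0 // ltW.
lra.
Qed.

(** Where the sign of [psi (pi r)] disagrees with [signf F pi], the two differ by at least 1. *)
Lemma symdiff_le_dist F (psi : T -> R) r :
  #|dictator r [set j | 0 <= psi j] ^^ F|%:R
    <= \sum_pi (signf R F pi - psi (pi r)) ^+ 2.
Proof.
rewrite -sum1_card natr_sum big_mkcond; apply: ler_sum => pi _.
rewrite !inE /signf; case: (pi \in F) => /=; rewrite ?andbF ?orbF ?andbT /=.
  case: (lerP 0 (psi (pi r))) => /= [_|h]; first by apply: sqr_ge0.
  nra.
case: (lerP 0 (psi (pi r))) => /= [h|_]; last by apply: sqr_ge0.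
nra.
Qed.

Lemma card_dictator r J : x * #|dictator r J|%:R = Nf * #|J|%:R.
Proof.
have := sum_perm1 (fun y => (y \in J)%:R : R) r.
rewrite -!natr_sum.
have -> : (\sum_(pi : {perm T}) (pi r \in J) = #|dictator r J|)%N.
  by rewrite -sum1_card [RHS]big_mkcond; apply: eq_bigr => pi _; rewrite inE; case: (_ \in _).
suff -> : (\sum_y (y \in J) = #|J|)%N by [].
by rewrite -sum1_card [RHS]big_mkcond; apply: eq_bigr => y _; case: (_ \in _).
Qed.

Lemma card_symdiff_trans (A B C : {set {perm T}}) :
  (#|A ^^ C| <= #|A ^^ B| + #|B ^^ C|)%N.
Proof.
apply: leq_trans (leq_card_setU _ _); apply: subset_leq_card.
apply/subsetP => pi; rewrite !inE.
by case: (pi \in A); case: (pi \in B); case: (pi \in C).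
Qed.

Lemma card_symdiff_diff (A B : {set {perm T}}) : (#|A| <= #|A ^^ B| + #|B|)%N.
Proof.
apply: leq_trans (leq_card_setU _ _); apply: subset_leq_card.
apply/subsetP => pi; rewrite !inE.
by case: (pi \in A); case: (pi \in B).
Qed.

Lemma symdiffC (A B : {set {perm T}}) : A ^^ B = B ^^ A.
Proof. exact: setUC. Qed.

(** Comparability makes the number of altered elements exactly the difference of the sizes. *)
Lemma resize_set J m : (m <= n)%N -> exists J' : {set T}, #|J'| = m /\
  ((J' \subset J) || (J \subset J')).
Proof.
move=> mn; have [mJ|Jm] := leqP m #|J|.
  have : (0 < #|[set A : {set T} | A \subset J & #|A| == m]|)%N.
    by rewrite cards_draws bin_gt0.
  by case/card_gt0P => A; rewrite inE => /andP[AJ /eqP Am]; exists A; rewrite AJ.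
have : (0 < #|[set A : {set T} | A \subset ~: J & #|A| == m - #|J|]|)%N.
  by rewrite cards_draws bin_gt0 leq_subLR cardsC.
case/card_gt0P => A; rewrite inE => /andP[AJ /eqP Am]; exists (J :|: A).
rewrite subsetUl orbT; split => //.
rewrite cardsU (_ : J :&: A = set0) ?cards0 ?subn0 ?Am ?subnKC // 1?ltnW //.
by apply/eqP; rewrite setI_eq0 disjoint_sym disjoints_subset.
Qed.

(** Resizing costs [n! / n] per element of the size difference. The size of the dictatorship of [J]
    differs from that of [F] by at most their symmetric difference, which is thus counted twice, and
    rounding [c * n] to [m] costs one further [n! / n]. *)
Lemma resize_dictator r J F (c : R) m : (m <= n)%N -> (0 < n)%N ->
  #|F|%:R = c * Nf -> `|x * c - m%:R| <= 1 ->
  exists J' : {set T}, #|J'| = m /\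
    x * #|dictator r J' ^^ F|%:R <= 2 * (x * #|dictator r J ^^ F|%:R) + Nf.
Proof.
move=> mn n0 Fc cm; have [J' [J'm JJ']] := resize_set J mn; exists J'; split=> //.
have N0 := fact_gt0R R T; have x0 : 0 < x by rewrite ltr0n.
have h1 := card_symdiff_trans (dictator r J') (dictator r J) F.
rewrite -(ler_nat R) natrD in h1; have {}h1 := ler_wpM2l (ltW x0) h1.
have h2 : x * #|dictator r J' ^^ dictator r J|%:R <= x * #|dictator r J ^^ F|%:R + Nf.
  have symE : x * #|dictator r J' ^^ dictator r J|%:R = Nf * `|#|J|%:R - m%:R|.
    have -> : dictator r J' ^^ dictator r J = dictator r ((J' :\: J) :|: (J :\: J')).
      by apply/setP => pi; rewrite !inE.
    rewrite card_dictator; congr (_ * _); rewrite -J'm.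
    case/orP: JJ' => sub; have := subset_leq_card sub => le.
      move: (sub); rewrite -setD_eq0 => /eqP->; rewrite set0U cardsD (setIidPr sub).
      by rewrite natrB // ger0_norm // subr_ge0 ler_nat.
    move: (sub); rewrite -setD_eq0 => /eqP->; rewrite setU0 cardsD (setIidPr sub).
    by rewrite natrB // distrC ger0_norm // subr_ge0 ler_nat.
  rewrite symE -[X in X * _](gtr0_norm N0) -normrM mulrBr -(card_dictator r).
  have := card_symdiff_diff (dictator r J) F; have := card_symdiff_diff F (dictator r J).
  rewrite symdiffC -!(ler_nat R) !natrD => /(ler_wpM2l (ltW x0)) g1 /(ler_wpM2l (ltW x0)) g2.
  rewrite Fc in g1 g2.
  move: cm; rewrite !ler_norml => /andP[c1 c2].
  have {}c1 := ler_wpM2l (ltW N0) c1; have {}c2 := ler_wpM2l (ltW N0) c2.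
  by apply/andP; split; lra.
lra.
Qed.

End Dictator.

(** * The stability theorem over a real field *)

Section Stability.
Variables (R : realFieldType) (T : finType).
Local Notation n := #|T|.
Local Notation x := (n%:R : R).
Local Notation Nf := (n`!%:R : R).
Implicit Types (a : T -> T -> R) (F : {set {perm T}}) (J : {set T}).
Local Notation "A '^^' B" := ((A :\: B) :|: (B :\: A)) (at level 52).

(** Rounding [psi] to its sign and resizing doubles the bound; the extra [1 / n] is at most [e],
    because [1 <= e ^+ 3 * x] and [e <= 1]. *)
Lemma dictator_of_approximation F (psi : T -> R) r (c eta e : R) m : (m <= n)%N -> (0 < n)%N ->
  #|F|%:R = c * Nf -> `|x * c - m%:R| <= 1 -> 0 < eta -> eta <= 1 ->
  0 < e -> e <= 1 -> 1 <= e ^+ 3 * x ->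
  eta * (\sum_pi (signf R F pi - psi (pi r)) ^+ 2) <= 2 ^+ 43 * e ^+ 2 * Nf ->
  exists J, #|J| = m /\ eta * #|dictator r J ^^ F|%:R <= 2 ^+ 45 * e * Nf.
Proof.
move=> mn n0 Fc cm eta0 eta1 e0 e1 ex h.
have [J' [J'm hJ']] := resize_dictator r [set j | 0 <= psi j] mn n0 Fc cm.
exists J'; split=> //.
have x0 : 0 < x by rewrite ltr0n.
have N0 := fact_gt0R R T.
have h1 := le_trans (ler_wpM2l (ltW eta0) (symdiff_le_dist F psi r)) h.
have h2 := ler_wpM2l (ltW x0) h1.
have h3 := ler_wpM2l (ltW eta0) hJ'.
have e31 : e ^+ 3 <= e by rewrite exprS ler_piMr ?exprn_ile1 // ltW.
have e21 : e ^+ 2 <= e by rewrite exprS ler_piMr // ltW.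
have ex1 : 1 <= e * x by apply: le_trans ex _; rewrite ler_pM2r.
have h4 : eta * Nf <= e * x * Nf by rewrite ler_pM2r //; lra.
have h5 : e ^+ 2 * (x * Nf) <= e * (x * Nf) by rewrite ler_pM2r // mulr_gt0.
have h6 : 0 <= e * (x * Nf) by rewrite !mulr_ge0 // ltW.
rewrite -(ler_pM2l x0); lra.
Qed.

Lemma stability a F (c eta e : R) m : (0 < n)%N -> (m <= n)%N ->
  #|F|%:R = c * Nf -> `|x * c - m%:R| <= 1 ->
  0 < eta -> eta <= c -> eta <= 1 - c ->
  (forall i j, \sum_pi (signf R F pi - lin a pi) * (pi i == j)%:R = 0) ->
  0 < e -> 1 <= e ^+ 3 * x ->
  \sum_pi (signf R F pi - lin a pi) ^+ 2 <= e ^+ 7 * Nf ->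
  exists r J, #|J| = m /\
    (eta * #|dictator r J ^^ F|%:R <= 2 ^+ 45 * e * Nf \/
     eta * #|inverses (dictator r J) ^^ F|%:R <= 2 ^+ 45 * e * Nf).
Proof.
move=> n0 mn Fc cm eta0 ec ec' orth e0 ex eps.
have N0 := fact_gt0R R T.
have x0 : 0 < x by rewrite ltr0n.
have eta1 : eta <= 1 by lra.
(* If [eta < 2 ^+ 20 * e], the bound holds for every dictatorship, as a symmetric difference has at
   most [n!] elements. Otherwise [e] is small and [n] is large. *)
have [ee|ee] := lerP (2 ^+ 20 * e) eta; last first.
  have [J [Jm _]] := resize_set set0 mn.
  have /card_gt0P [r _] := n0; exists r, J; split=> //; left.
  have : #|dictator r J ^^ F|%:R <= Nf.
    have := sum_perm_const T (1 : R); rewrite mulr1 => <-.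
    rewrite -sum1_card natr_sum big_mkcond; apply: ler_sum => pi _.
    by case: ifP.
  move=> h; apply: le_trans (_ : 2 ^+ 20 * e * Nf <= _).
    by apply: ler_pM => //; apply: ltW.
  rewrite ler_pM2r // ler_pM2r //; lra.
have e1 : e <= 1 by lra.
have f1 := signf_sqr R F.
have e31 : e ^+ 3 <= e by rewrite exprS ler_piMr ?exprn_ile1 // ltW.
have ex1 : 1 <= e * x by apply: le_trans ex _; rewrite ler_pM2r.
have etax : 2 ^+ 20 <= eta * x by have := ler_wpM2r (ltW x0) ee; have := ex1; lra.
have x10 : 10 <= x by have := ler_wpM2r (ltW x0) eta1; lra.
have n10 : (10 <= n)%N by rewrite (ler_nat R 10) in x10.
have n2 : (2 <= n)%N := leq_trans (isT : 2 <= 10)%N n10.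
have a4 := mixed_le4 f1 orth n2.
have q16 Q : quadE a Q <= 16.
  have : `|mixed a Q.1.1 Q.1.2 Q.2.1 Q.2.2| ^+ 2 <= 4 ^+ 2.
    by rewrite lerXn2r ?nnegrE ?ler0n ?a4.
  by rewrite real_normK ?num_real // /quadE; lra.
have K2 := disjoint_mass_small n10 a4 f1 e0 e1 eps.
have e72 : e ^+ 7 <= e ^+ 2.
  by rewrite (exprD e 5 2) ler_piMl ?sqr_ge0 // exprn_ile1 // ltW.
have e21 : e ^+ 2 <= e by rewrite exprS ler_piMr // ltW.
have Mlow : eta * x ^+ 3 / 4 <= mass a.
  apply: mass_lower n2 Fc eta0 ec ec' _; apply: le_trans eps _.
  by rewrite ler_pM2r //; lra.
have x30 : 0 < x ^+ 3 by rewrite exprn_gt0.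
have M0 : 0 < mass a by apply: lt_le_trans Mlow; rewrite divr_gt0 ?mulr_gt0.
(* From [2 ^+ 20 * e <= eta], the disjoint mass is at most [eta ^+ 2 * x ^+ 6 / 2 ^+ 7], while half
   the squared mass is at least [eta ^+ 2 * x ^+ 6 / 2 ^+ 5]. *)
have K2lt : disjoint_mass a < mass a ^+ 2 / 2.
  have Ml2 : (eta * x ^+ 3 / 4) ^+ 2 <= mass a ^+ 2.
    by rewrite lerXn2r ?nnegrE ?mulr_ge0 ?invr_ge0 ?ler0n // ltW.
  have ee2 : (2 ^+ 20 * e) ^+ 2 <= eta ^+ 2.
    by rewrite lerXn2r ?nnegrE ?mulr_ge0 ?exprn_ge0 ?ler0n // ltW.
  have x60 : 0 < x ^+ 6 by rewrite exprn_gt0.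
  have := ler_wpM2r (ltW x60) ee2.
  have : 0 < eta ^+ 2 * x ^+ 6 by rewrite mulr_gt0 ?exprn_gt0.
  lra.
have [r [Mr|Mr]] := exists_heavy_line M0 K2lt; exists r.
  have [psi hpsi] := row_approximation q16 K2 Mlow Mr eta0 eta1 e0 ee ex eps.
  have [J [Jm hJ]] := dictator_of_approximation mn n0 Fc cm eta0 eta1 e0 e1 ex hpsi.
  by exists J; split=> //; left.
(* A heavy column is a heavy row of [transpose a], whose linear function approximates the sign of
   [inverses F]. *)
have epsT : \sum_pi (signf R (inverses F) pi - lin (transpose a) pi) ^+ 2 <= e ^+ 7 * Nf.
  rewrite (reindex_inj (@invg_inj _)) /=; apply: le_trans eps.
  rewrite le_eqVlt; apply/orP; left; apply/eqP; apply: eq_bigr => pi _.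
  by rewrite lin_transpose /signf inE invgK.
have q16T Q : quadE (transpose a) Q <= 16 by rewrite (quadE_transpose a).
have Fc' : #|inverses F|%:R = c * Nf by rewrite card_inverses.
rewrite -(disjoint_mass_transpose a) in K2; rewrite -(mass_transpose a) in Mlow Mr.
have [psi hpsi] := row_approximation q16T K2 Mlow Mr eta0 eta1 e0 ee ex epsT.
have [J [Jm hJ]] := dictator_of_approximation mn n0 Fc' cm eta0 eta1 e0 e1 ex hpsi.
exists J; split=> //; right.
rewrite -[X in X%:R](card_inverses) in hJ; apply: le_trans hJ.
rewrite le_eqVlt; apply/orP; left; apply/eqP; congr (_ * _%:R); apply: eq_card => pi.
by rewrite !inE invgK.
Qed.

End Stability.

(** * Dictatorships as unions of cosets, and the transfer to algebraic numbers *)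

Lemma dictator_cosets n r (J : {set 'I_n}) : union_disj_cosets (dictator r J) #|J|.
Proof.
exists [set (r, j) | j in J]; split.
- by rewrite card_imset // => j j' [].
- move=> _ _ /imsetP[j _ ->] /imsetP[j' _ ->] jj'; rewrite -setI_eq0; apply/eqP/setP => s.
  rewrite !inE /=; apply: contraNF jj' => /andP[/eqP-> /eqP->]; exact: eqxx.
apply/setP => s; rewrite inE; apply/idP/bigcupP => [sJ|[_ /imsetP[j jJ ->]]].
  by exists (r, s r); [apply/imsetP; exists (s r) | rewrite inE].
by rewrite inE /= => /eqP->.
Qed.

Lemma inverse_dictator_cosets n r (J : {set 'I_n}) :
  union_disj_cosets (inverses (dictator r J)) #|J|.
Proof.
exists [set (j, r) | j in J]; split.
- by rewrite card_imset // => j j' [].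
- move=> _ _ /imsetP[j _ ->] /imsetP[j' _ ->] jj'; rewrite -setI_eq0; apply/eqP/setP => s.
  rewrite !inE /=; apply: contraNF jj' => /andP[/eqP jr /eqP j'r].
  by rewrite (@perm_inj _ s j j') // jr j'r.
apply/setP => s; rewrite !inE; apply/idP/bigcupP => [sJ|[_ /imsetP[j jJ ->]]].
  by exists ((s^-1)%g r, r); [apply/imsetP; exists ((s^-1)%g r) | rewrite inE /= permKV].
by rewrite inE /= => /eqP<-; rewrite permK.
Qed.

Theorem theorem1 :
  exists C : algC, 0 < C /\
  forall (n : nat) (F : {set {perm 'I_n}}) (c : algC),
    (1 <= n)%N ->
    #|F|%:R = c * n`!%:R ->
    0 < c -> c < 1 ->
    forall f1 : {perm 'I_n} -> algC,
      is_projU1 (fun s => 2 * indf F s - 1) f1 ->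
      let eps := expectS (fun s => (2 * indf F s - 1 - f1 s) ^+ 2) in
      let eta := Num.min c (1 - c) in
      let err := 7.-root eps + (3.-root (n%:R))^-1 in
      exists (G : {set {perm 'I_n}}) (d : algC) (m : nat),
        [/\ union_disj_cosets G m,
            m%:R = d * n%:R,
            `|d - c| <= C * err
          & #|(G :\: F) :|: (F :\: G)|%:R / n`!%:R <= C / eta * err].
Proof.
(* The constant is that of [stability]; the bound on [d - c] holds with room to spare. *)
exists (2 ^+ 45); split=> [|n F c n1 Fc c0 c1 f1 [[a [a_real f1E]] orth] eps eta err].
  by rewrite exprn_gt0.
have n0 : 0 < n%:R :> algC by rewrite ltr0n.
have N0 : 0 < n`!%:R :> algC by rewrite ltr0n fact_gt0.
(* All data are real, so the argument runs in the real field [algR], and the conclusions return to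
   [algC] through [algRval]. *)
pose a' i j : algR := in_algR (a_real i j).
pose c' : algR := in_algR (gtr0_real c0).
pose eta' : algR := Num.min c' (1 - c').
have etaE : algRval eta' = eta.
  by rewrite /eta' /Order.min (fun_if algRval).
pose g s : algR := signf algR F s - lin a' s.
have gE s : algRval (g s) = 2 * indf F s - 1 - f1 s.
  rewrite /g -[signf algR F s]/(2 * (s \in F)%:R - 1) !rmorphB rmorphM !rmorph_nat rmorph1.
  rewrite f1E /lin rmorph_sum; congr (_ - _).
  apply: eq_bigr => i _; rewrite (bigD1 (s i)) //= big1 ?addr0 => [|j ji].
    by rewrite /indf inE eqxx mulr1.
  by rewrite /indf inE eq_sym (negbTE ji) mulr0.
have orth' i j : \sum_s g s * (s i == j)%:R = 0.
  apply: val_inj; have := orth i j; rewrite /innerS => /eqP.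
  rewrite mulf_eq0 invr_eq0 (gt_eqF N0) /= => /eqP => h.
  rewrite -[LHS]/(algRval _) -[RHS]/(0 : algC) rmorph_sum -[RHS]h; apply: eq_bigr => s _.
  by rewrite rmorphM rmorph_nat -[X in X * _]/(algRval (g s)) gE /indf inE.
pose eps' : algR := (\sum_s g s ^+ 2) / n`!%:R.
have epsE : algRval eps' = eps.
  rewrite /eps' /eps /expectS fmorph_div rmorph_nat rmorph_sum mulrC; congr (_ * _).
  by apply: eq_bigr => s _; rewrite rmorphXn -[X in X ^+ _]/(algRval (g s)) gE.
have eps0 : 0 <= eps.
  have : 0 <= eps' by rewrite divr_ge0 ?ler0n // sumr_ge0 // => s _; apply: sqr_ge0.
  by rewrite -epsE.
have r7 : 0 <= 7.-root eps by rewrite rootC_ge0.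
have r3 : 0 < (3.-root n%:R)^-1 :> algC by rewrite invr_gt0 rootC_gt0.
have err0 : 0 < err by rewrite ltr_wpDl.
(* [stability] is applied with [e = err]: this dominates both summands, so [err ^+ 7] is at least
   [eps] and [err ^+ 3] at least [1 / n]. *)
pose e' : algR := in_algR (gtr0_real err0).
have e'0 : 0 < e' by [].
have N0' : 0 < n`!%:R :> algR by rewrite ltr0n fact_gt0.
have n0' : 0 < n%:R :> algR by rewrite ltr0n.
have epse : \sum_s g s ^+ 2 <= e' ^+ 7 * n`!%:R.
  rewrite -ler_pdivrMr //.
  have : eps <= err ^+ 7.
    rewrite -{1}(rootCK (isT : (0 < 7)%N) eps) lerXn2r ?nnegrE //; first exact: ltW.
    by rewrite lerDl ltW.
  by rewrite -epsE -[err]/(algRval e') -rmorphXn.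
have ex : 1 <= e' ^+ 3 * n%:R.
  rewrite -ler_pdivrMr // mul1r.
  have : n%:R^-1 <= err ^+ 3.
    rewrite -{1}(rootCK (isT : (0 < 3)%N) n%:R) -exprVn lerXn2r ?nnegrE ?(ltW r3) ?(ltW err0) //.
    by rewrite lerDr.
  by rewrite -[err]/(algRval e') -rmorphXn -(rmorph_nat algRval) -fmorphV.
(* This is the integer part of [c * n]. *)
pose m := (#|F| * n %/ n`!)%N.
have FleN : (#|F| <= n`!)%N.
  have := max_card (mem F); rewrite (_ : #|{perm 'I_n}| = n`!) //.
  have := card_Sym [set: 'I_n]; rewrite cardsT card_ord => <-.
  by apply: eq_card => s; rewrite [RHS]inE; apply/esym/subsetP => y; rewrite inE.
have mn : (m <= n)%N.
  rewrite /m -[X in (_ <= X)%N](mulnK n (fact_gt0 n)) leq_div2r // mulnC.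
  by rewrite leq_mul2l FleN orbT.
have Fc' : #|F|%:R = c' * n`!%:R.
  by apply: val_inj; rewrite -[LHS]/(algRval _) -[RHS]/(algRval (_ * _)) rmorphM !rmorph_nat.
have cm : `|n%:R * c' - m%:R| <= 1.
  have lo : (m * n`! <= #|F| * n)%N by rewrite leq_trunc_div.
  have hi : (#|F| * n < m.+1 * n`!)%N by rewrite ltn_ceil // fact_gt0.
  move: lo hi; rewrite -(ler_nat algR) -(ltr_nat algR) !natrM -[m.+1%:R]natr1 Fc'.
  rewrite -[_ * n%:R]mulrAC !ler_pM2r // ltr_pM2r // => lo hi.
  rewrite ler_norml; apply/andP; split; lra.
have c'0 : 0 < c' by [].
have c'1 : c' < 1 by [].
have eta'0 : 0 < eta' by rewrite lt_min c'0 subr_gt0.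
have ec : eta' <= c' by rewrite ge_min lexx.
have ec' : eta' <= 1 - c' by rewrite ge_min lexx orbT.
(* The left side is at most [1 / n], hence at most [e']: for [e' <= 1] because [1 <= e' ^+ 3 * n],
   for [e' > 1] trivially. *)
have dc : `|m%:R / n%:R - c'| <= 2 ^+ 45 * e'.
  have -> : m%:R / n%:R - c' = - ((n%:R * c' - m%:R) / n%:R) by field; rewrite gt_eqF.
  rewrite normrN normrM [X in _ * X]gtr0_norm ?invr_gt0 // ler_pdivrMr //.
  apply: le_trans cm _.
  have [e1|e1] := lerP e' 1.
    have e31 : e' ^+ 3 <= e' by rewrite exprS ler_piMr ?exprn_ile1 // ltW.
    have := ler_wpM2r (ltW n0') e31; have : 0 <= e' * n%:R by rewrite mulr_ge0 // ltW.
    lra.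
  have n1R : 1 <= n%:R :> algR by rewrite (ler_nat _ 1).
  have := ler_pM ler01 ler01 (ltW e1) n1R; lra.
have final (G : {set {perm 'I_n}}) : union_disj_cosets G m ->
    eta' * #|(G :\: F) :|: (F :\: G)|%:R <= 2 ^+ 45 * e' * n`!%:R ->
    exists (G : {set {perm 'I_n}}) (d : algC) (m : nat),
        [/\ union_disj_cosets G m, m%:R = d * n%:R, `|d - c| <= 2 ^+ 45 * err
          & #|(G :\: F) :|: (F :\: G)|%:R / n`!%:R <= 2 ^+ 45 / eta * err].
  move=> Gm Gle; exists G, (m%:R / n%:R), m; split=> //.
  - by rewrite divfK // gt_eqF.
  - have : `|algRval (m%:R / n%:R - c')| <= algRval (2 ^+ 45 * e') := dc.
    by rewrite rmorphB fmorph_div rmorphM rmorphXn !rmorph_nat.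
  have : #|(G :\: F) :|: (F :\: G)|%:R / n`!%:R <= 2 ^+ 45 / eta' * e'.
    rewrite ler_pdivrMr // mulrAC -mulrA mulrAC -(ler_pM2l eta'0).
    apply: le_trans Gle _; rewrite le_eqVlt; apply/orP; left; apply/eqP.
    by field; rewrite gt_eqF.
  move=> h; have {h} : algRval (#|(G :\: F) :|: (F :\: G)|%:R / n`!%:R)
     <= algRval (2 ^+ 45 / eta' * e') := h.
  by rewrite -etaE fmorph_div rmorphM fmorph_div rmorphXn !rmorph_nat.
have nT : #|'I_n| = n := card_ord n.
have := @stability algR 'I_n a' F c' eta' e' m; rewrite nT.
move=> /(_ n1 mn Fc' cm eta'0 ec ec' orth' e'0 ex epse) [r [J [Jm [h|h]]]].
  by apply: final h; rewrite -Jm; apply: dictator_cosets.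
by apply: final h; rewrite -Jm; apply: inverse_dictator_cosets.
Qed.
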